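(* For every integer $n\ge 2$ and every $r\in[0,\frac{\pi}{2}]$, the volume $V_n(r)$ of a ball of radius $r$ (centered at any point) in the lens space $L(n;1)$ is $$V_n(r)=\begin{cases}2\pi(r-\sin r\cos r) & \text{if } r\le \frac{\pi}{n},\\[1ex] \dfrac{2\pi^2}{n}-2\pi\cos^2 r\,\tan\dfrac{\pi}{n} & \text{otherwise.}\end{cases}$$
   Context: Let $\mathbb{S}^3=\{(\alpha,\beta)\in\mathbb{C}^2 : |\alpha|^2+|\beta|^2=1\}$ with its round metric of constant curvature $1$, and let $Z_n\subset\mathbb{C}$ be the cyclic group of $n$th roots of unity acting freely on $\mathbb{S}^3$ by $\omega\cdot(\alpha,\beta)=(\omega\alpha,\omega\beta)$. The lens space $L(n;1)=\mathbb{S}^3/Z_n$ carries the unique Riemannian metric making the quotient map $\mathbb{S}^3\to L(n;1)$ a Riemannian submersion (here a local isometry). The associated Riemannian distance is $$d([p],[q])=\min_{\omega\in Z_n} d_{\mathbb{S}^3}(\omega\cdot p,q),\qquad d_{\mathbb{S}^3}(p,q)=\arccos(p\cdot q),$$ where $p\cdot q$ is the real Euclidean inner product on $\mathbb{R}^4=\mathbb{C}^2$. The ball of radius $r$ centered at $q\in L(n;1)$ is $\{x\in L(n;1): d(x,q)\le r\}$, and volume is Riemannian volume (not normalized; equivalently, $\frac1n$ times the Riemannian volume of the preimage in $\mathbb{S}^3$, where $\mathbb{S}^3$ has total volume $2\pi^2$). *)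

(* Defs.v *)
From HB Require Import structures.
From mathcomp Require Import all_boot all_order all_algebra.
From mathcomp Require Import complex ring.
From mathcomp Require Import all_classical all_reals all_analysis.
Import Order.TTheory GRing.Theory Num.Theory.
Import numFieldNormedType.Exports.

Set Implicit Arguments.
Unset Strict Implicit.
Unset Printing Implicit Defensive.

Local Open Scope classical_set_scope.
Local Open Scope ring_scope.
Local Open Scope complex_scope.
Local Open Scope quotient_scope.

Definition C2 (R : realType) : Type := (R[i] * R[i])%type.

(* [C2] is identified with [R^4], so [dot] is the real Euclidean inner product. *)
Definition real4 (R : realType) (p : C2 R) : 'rV[R]_4 :=
  \row_(k < 4) [:: complex.Re p.1; complex.Im p.1; complex.Re p.2; complex.Im p.2]`_k.

Definition dot (R : realType) (p q : C2 R) : R :=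
  \sum_(k < 4) real4 p 0 k * real4 q 0 k.

Definition S3 (R : realType) : Type :=
  {p : R[i] * R[i] | `|p.1| ^+ 2 + `|p.2| ^+ 2 == 1}.

HB.instance Definition _ (R : realType) := Choice.on (S3 R).

Definition sphere_dist (R : realType) (p q : C2 R) : R := acos (dot p q).

Definition rot (R : realType) (w : R[i]) (p : C2 R) : C2 R :=
  (w * p.1, w * p.2).

Definition lens_rel (R : realType) (n : nat) : rel (S3 R) :=
  fun p q => `[< exists2 w : R[i],
                   n.-unity_root w & rot w (val p) = val q >].

Lemma unity_root_inv (R : realType) (n : nat) (w : R[i]) :
  n.-unity_root w -> n.-unity_root w^-1.
Proof. by rewrite !unity_rootE exprVn => /eqP ->; rewrite invr1. Qed.

Lemma lens_rel_refl (R : realType) n : reflexive (@lens_rel R n).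
Proof.
move=> p; apply/asboolP; exists 1; first by rewrite unity_rootE expr1n.
by rewrite /rot !mul1r; case: (val p).
Qed.

Lemma rot_neq0 (R : realType) (w : R[i]) (p q : S3 R) :
  rot w (val p) = val q -> w != 0.
Proof.
move=> pq; apply/eqP => w0; have /eqP := valP q; rewrite -pq w0 /rot /= !mul0r.
by rewrite normr0 expr0n addr0 => /eqP; rewrite eq_sym oner_eq0.
Qed.

(* For [n = 0] every [w] is accepted by [unity_root], but only those of modulus
   [1] map [S3] to itself, so this is an equivalence for all [n]. *)
Lemma lens_rel_sym (R : realType) n : symmetric (@lens_rel R n).
Proof.
suff sym p q : lens_rel n p q -> lens_rel (R := R) n q p.
  by move=> p q; apply/idP/idP; apply: sym.
move=> /asboolP[w wn pq]; apply/asboolP; exists w^-1; first exact: unity_root_inv.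
have w0 := rot_neq0 pq.
by rewrite -pq /rot /= !mulKf//; case: (val p).
Qed.

Lemma lens_rel_trans (R : realType) n : transitive (@lens_rel R n).
Proof.
move=> q p s /asboolP[w wn pq] /asboolP[z zn qs]; apply/asboolP.
exists (z * w); last by rewrite -qs -pq /rot /= !mulrA.
move: wn zn; rewrite !unity_rootE exprMn => /eqP -> /eqP ->.
by rewrite mulr1.
Qed.

Canonical lens_equiv (R : realType) (n : nat) : equiv_rel (S3 R) :=
  EquivRel (@lens_rel R n)
    (@lens_rel_refl R n) (@lens_rel_sym R n) (@lens_rel_trans R n).

Definition lens (R : realType) (n : nat) : Type := {eq_quot (@lens_equiv R n)}.

Definition lens_proj (R : realType) (n : nat) (p : S3 R) : lens R n :=
  \pi_({eq_quot (@lens_equiv R n)}) p.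

(* [w] ranges over a finite nonempty set when [0 < n], so this [inf] is a
   minimum; [lens_dist_proj] below shows independence of the representatives. *)
Definition lens_dist (R : realType) (n : nat) (x y : lens R n) : R :=
  inf [set sphere_dist (rot w (val (repr x))) (val (repr y)) |
        w in [set w : R[i] | n.-unity_root w]].

Lemma dot_rot (R : realType) (z : R[i]) (p q : C2 R) :
  `|z| = 1 -> dot (rot z p) (rot z q) = dot p q.
Proof.
case: z => a b; rewrite normc_def /= => /(congr1 (fun x => x ^+ 2)).
rewrite -rmorphXn /= sqr_sqrtr ?addr_ge0 ?sqr_ge0// expr1n.
case=> /(canRL (addrK _)) ab.
case: p q => [[p1 p2] [p3 p4]] [[q1 q2] [q3 q4]].
rewrite /dot !big_ord_recl !big_ord0 !mxE /=.
by ring: ab.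
Qed.

Lemma norm_rot (R : realType) (w : R[i]) (p q : S3 R) :
  rot w (val p) = val q -> `|w| = 1.
Proof.
move=> pq; have /eqP := valP q; rewrite -pq /rot /= !normrM !exprMn -mulrDr.
rewrite (eqP (valP p)) mulr1 => /eqP; rewrite sqrp_eq1 ?normr_ge0// => /eqP.
by [].
Qed.

Lemma lens_dist_proj (R : realType) n (p q : S3 R) :
  lens_dist (lens_proj n p) (lens_proj n q) =
  inf [set sphere_dist (rot w (val p)) (val q) |
        w in [set w : R[i] | n.-unity_root w]].
Proof.
have projE s : exists2 z : R[i], n.-unity_root z &
    rot z (val s) = val (repr (lens_proj n s)).
  apply/asboolP; rewrite -[asbool _]/(lens_equiv R n s (repr (lens_proj n s))).
  by rewrite -eqmodE reprK.
rewrite /lens_dist; have [z zn pz] := projE p; have [t tn qt] := projE q.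
have rotM (a b : R[i]) (s : C2 R) : rot a (rot b s) = rot (a * b) s.
  by rewrite /rot /= !mulrA.
have rootM (a b : R[i]) :
    n.-unity_root a -> n.-unity_root b -> n.-unity_root (a * b).
  by rewrite !unity_rootE exprMn => /eqP -> /eqP ->; rewrite mulr1.
have z0 := rot_neq0 pz; have t0 := rot_neq0 qt; have t1 := norm_rot qt.
rewrite -pz -qt; congr inf; apply/seteqP; split=> _ [w wn <-].
- exists (w * z / t); first by rewrite /= !rootM ?unity_root_inv.
  by rewrite /sphere_dist -(dot_rot _ _ t1) !rotM mulrC divfK.
- exists (w * t / z); first by rewrite /= !rootM ?unity_root_inv.
  rewrite /sphere_dist rotM divfK// -(dot_rot _ (val q) t1) rotM.
  by rewrite [t * w]mulrC.
Qed.

Definition lens_ball (R : realType) (n : nat) (q : lens R n) (r : R) :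
    set (lens R n) :=
  [set x | lens_dist x q <= r].

Definition expi (R : realType) (t : R) : R[i] := cos t +i* sin t.

(* Hopf coordinates [(eta, xi1, xi2)]: the point
   [(cos eta e^(i xi1), sin eta e^(i xi2))] of the sphere. *)
Definition hopf_coord (R : realType) (u : R * R * R) : C2 R :=
  ((cos u.1.1)%:C * expi u.1.2, (sin u.1.1)%:C * expi u.2).

Lemma hopf_coord_sphere (R : realType) (u : R * R * R) :
  `|(hopf_coord u).1| ^+ 2 + `|(hopf_coord u).2| ^+ 2 == 1.
Proof.
rewrite /hopf_coord /= !normrM !exprMn !normc_def /= -!rmorphXn /=.
rewrite !cos2Dsin2 !expr0n /= !addr0 !sqrtr1 !expr1n !mulr1.
by rewrite !sqr_sqrtr ?sqr_ge0// -rmorphD /= cos2Dsin2.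
Qed.

Definition hopf (R : realType) (u : R * R * R) : S3 R :=
  exist _ (hopf_coord u) (hopf_coord_sphere u).

(* On this open box [hopf] is a chart of the sphere: a diffeomorphism onto the
   open set where both complex coordinates lie outside the ray [0, +oo[, whose
   complement is null for the Riemannian volume. *)
Definition hopf_dom (R : realType) : set (R * R * R) :=
  (`]0, (pi / 2)[ `*` `]0, (2 * pi)[) `*` `]0, (2 * pi)[.

Definition basis3 (R : realType) (i : 'I_3) : R * R * R :=
  ((i == 0)%:R, (i == 1)%:R, (i == 2)%:R).

Definition hopf_jac (R : realType) (u : R * R * R) : 'M[R]_(3, 4) :=
  \matrix_(i < 3, k < 4)
    'D_(basis3 R i) (fun v : R * R * R => real4 (val (hopf v)) 0 k) u.

(* The matrix [g_ij] of the round metric (induced by the Euclidean metric of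
   [R^4]) in Hopf coordinates. *)
Definition hopf_metric (R : realType) (u : R * R * R) : 'M[R]_3 :=
  hopf_jac u *m (hopf_jac u)^T.

(* Riemannian volume in coordinates: the integral of [sqrt (det g)] against
   Lebesgue measure. *)
Definition sphere_vol (R : realType) (A : set (S3 R)) : \bar R :=
  (\int[(lebesgue_measure \x lebesgue_measure) \x lebesgue_measure]_(u in
     @hopf_dom R `&` (@hopf R) @^-1` A)
     (Num.sqrt (\det (hopf_metric u)))%:E)%E.

(* The projection is an [n]-sheeted Riemannian covering. *)
Definition lens_vol (R : realType) (n : nat) (A : set (lens R n)) : \bar R :=
  ((n%:R^-1)%:E * sphere_vol (@lens_proj R n @^-1` A))%E.

(* Main.v *)
(** The round volume is cos t * sin t dt dx dy in Hopf coordinates, and whether a point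
    lies in the ball around the class of [p] depends only on its Hermitian product [h]
    with [p], a point of the unit disc. The law of [h] is independent of [p]: shifting
    the two angles shows that it is rotation invariant, and that [|h|^2] is an affine
    function of the height of a uniform point of the 2-sphere along a tilted axis. By
    Archimedes that height is uniform; here this is derived from the invariance of the
    planar density 1 / sqrt (1 - z^2 - y^2) under rotations, a rotation being a product
    of shears, each of which preserves Lebesgue measure by translation invariance. It
    remains to measure the set of points [h] of the disc such that [Re (w h)] is at least
    [cos r] for some [n]th root of unity [w]. In the sector [|arg h| <= pi / n] only
    [w = 1] matters, and integrating over the radius first gives
    \int_{-m}^{m} (2 - 2 cos^2 r / cos^2 x) dx = 4 (m - cos^2 r tan m) with
    [m = min (r, pi / n)]. *)

Require Import Defs.
From HB Require Import structures.
From mathcomp Require Import all_boot all_order all_algebra.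
From mathcomp Require Import complex ring lra.
From mathcomp Require Import all_classical all_reals all_analysis measurable_realfun.
Import Order.TTheory GRing.Theory Num.Theory.
Import numFieldNormedType.Exports.

Set Implicit Arguments.
Unset Strict Implicit.
Unset Printing Implicit Defensive.

Local Open Scope classical_set_scope.
Local Open Scope ring_scope.

(** * Tonelli's theorem over products of sets *)

Section product.
Local Open Scope ereal_scope.
Context d1 d2 (T1 : measurableType d1) (T2 : measurableType d2) {R : realType}.
Variables (m1 : {sigma_finite_measure set T1 -> \bar R})
  (m2 : {sigma_finite_measure set T2 -> \bar R}).

Lemma ge0_integral_setX (F : T1 * T2 -> \bar R) (A : set T1) (B : set T2) :
  measurable A -> measurable B ->
  measurable_fun setT F -> (forall u, 0 <= F u) ->
  \int[m1 \x m2]_(u in A `*` B) F u =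
  \int[m1]_(x in A) \int[m2]_(y in B) F (x, y).
Proof.
move=> mA mB mf f0.
rewrite integral_mkcond fubini_tonelli1; last 2 first.
  by apply/(measurable_restrictT _ _).1; [exact: measurableX|exact: measurable_funTS].
  by move=> u; rewrite patchE; case: ifPn.
rewrite [RHS]integral_mkcond; apply: eq_integral => x _.
rewrite /fubini_F patchE; case: ifPn => xA.
  rewrite [RHS]integral_mkcond; apply: eq_integral => y _.
  by rewrite !patchE in_setX xA.
apply: integral0_eq => y _.
by rewrite patchE in_setX (negbTE xA).
Qed.

Lemma measurable_ge0_integral2 (G : T1 * T2 -> \bar R) (B : set T2) : measurable B ->
  measurable_fun setT G -> (forall u, 0 <= G u) ->
  measurable_fun setT (fun x => \int[m2]_(y in B) G (x, y)).
Proof.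
move=> mB mG G0.
have := @measurable_fun_fubini_tonelli_F _ _ _ _ R m2 (G \_ (setT `*` B)).
have mGB : measurable_fun setT (G \_ (setT `*` B)).
  by apply/(measurable_restrictT _ _).1; [exact: measurableX|exact: measurable_funTS].
have GB0 x : 0 <= (G \_ (setT `*` B)) x by rewrite patchE; case: ifPn.
move=> /(_ mGB GB0); apply: eq_measurable_fun => x _.
rewrite /fubini_F [RHS]integral_mkcond; apply: eq_integral => y _.
by rewrite !patchE in_setX in_setT.
Qed.

(** Lets Tonelli be iterated for three factors. The rectangles built from the two exhaustions are
    enumerated by coding pairs of indices as naturals; a number coding no pair contributes the empty
    set. *)
Lemma sigma_finite_product : sigma_finite setT (m1 \x m2).
Proof.
have [F TF Foo] := sigma_finiteT m1; have [H TH Hoo] := sigma_finiteT m2.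
exists (fun k => if unpickle k is Some (i, j) then F i `*` H j else set0).
  apply/seteqP; split=> // -[x y] _.
  have [i _ Fx] : (\bigcup_i F i) x by rewrite -TF.
  have [j _ Hy] : (\bigcup_j H j) y by rewrite -TH.
  by exists (pickle (i, j)) => //=; rewrite pickleK.
move=> k; case: unpickle => [[i j]|]; last by rewrite measure0.
have [mF Fi] := Foo i; have [mH Hj] := Hoo j.
split; first exact: measurableX.
by rewrite product_measure1E// lte_mul_pinfty// ge0_fin_numE.
Qed.

End product.

Lemma ge0_integral_setX3 d1 d2 d3 (T1 : measurableType d1) (T2 : measurableType d2)
    (T3 : measurableType d3) {R : realType} (m1 : {sigma_finite_measure set T1 -> \bar R})
    (m2 : {sigma_finite_measure set T2 -> \bar R}) (m3 : {sigma_finite_measure set T3 -> \bar R})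
    (F : T1 * T2 * T3 -> \bar R) (A : set T1) (B : set T2) (C : set T3) :
  measurable A -> measurable B -> measurable C ->
  measurable_fun setT F -> (forall u, 0 <= F u)%E ->
  (\int[(m1 \x m2) \x m3]_(u in (A `*` B) `*` C) F u =
  \int[m1]_(x in A) \int[m2]_(y in B) \int[m3]_(z in C) F (x, y, z))%E.
Proof.
move=> mA mB mC mF F0.
(* Products of sigma-finite measures have no canonical sigma-finite structure. *)
pose m12 : {sigma_finite_measure set (T1 * T2)%type -> \bar R} :=
  HB.pack (m1 \x m2)%E
    (Measure_isSigmaFinite.Build _ _ _ (m1 \x m2)%E (sigma_finite_product m1 m2)).
have mAB := measurableX mA mB.
refine (eq_trans (@ge0_integral_setX _ _ _ _ R m12 m3 F _ _ mAB mC mF F0) _).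
apply: (@ge0_integral_setX _ _ _ _ R m1 m2 (fun v => (\int[m3]_(z in C) F (v, z))%E)) => //.
  exact: (@measurable_ge0_integral2 _ _ _ _ R m3 F).
by move=> v; apply: integral_ge0.
Qed.

Lemma measurable_setbool d (T : measurableType d) (p : T -> bool) :
  measurable_fun setT p -> measurable [set x | p x].
Proof. by move=> /(_ measurableT [set true]); rewrite setTI; apply. Qed.

Lemma measurable_cos {R : realType} : measurable_fun setT (@cos R).
Proof. by apply: continuous_measurable_fun; exact: continuous_cos. Qed.

Lemma measurable_sin {R : realType} : measurable_fun setT (@sin R).
Proof. by apply: continuous_measurable_fun; exact: continuous_sin. Qed.

Lemma measurable_sqrt {R : realType} : measurable_fun setT (@Num.sqrt R).
Proof. by apply: continuous_measurable_fun; exact: sqrt_continuous. Qed.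

Lemma mul_cos_sin_ge0 {R : realType} (t : R) : t \in `]0, (pi / 2)[ -> 0 <= cos t * sin t.
Proof.
have pi0 := @pi_gt0 R; rewrite in_itv/= => /andP[t0 tpi]; rewrite mulr_ge0//.
  by apply: cos_ge0_pihalf; apply/andP; split; lra.
by apply: sin_ge0_pi; apply/andP; split; lra.
Qed.

(** * Change of variables on the line *)

Section integral_lebesgue.
Local Open Scope ereal_scope.
Context {R : realType}.
Local Notation mu := (@lebesgue_measure R).
Implicit Types (f g : R -> \bar R) (F w : R -> R) (a b c : R).

Lemma measurable_fun_subgraph w a b : measurable_fun setT w ->
  measurable_fun setT (fun u : R * R => (u.1 \in `]a, b[) && (0 <= u.2 < w u.1)%R).
Proof.
move=> mw; under eq_fun do rewrite in_itv/=.
apply: measurable_and; apply: measurable_and.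
- by apply: measurable_fun_ltr => //; exact: measurable_cst.
- by apply: measurable_fun_ltr => //; exact: measurable_cst.
- by apply: measurable_fun_ler => //; exact: measurable_cst.
- by apply: measurable_fun_ltr => //; exact: measurableT_comp.
Qed.

(* A measure with density [w] is the first marginal of planar Lebesgue measure
   restricted to the region under the graph of [w]. *)
Lemma integral_subgraph w f a b :
  measurable_fun setT w -> (forall x, x \in `]a, b[ -> (0 <= w x)%R) ->
  measurable_fun setT f -> (forall x, 0 <= f x) ->
  \int[mu \x mu]_(u in [set u | (u.1 \in `]a, b[) && (0 <= u.2 < w u.1)%R]) f u.1 =
  \int[mu]_(x in `]a, b[) (f x * (w x)%:E).
Proof.
move=> mw w0 mf f0; set E := [set u | _].
have mE : measurable E by apply: measurable_setbool; exact: measurable_fun_subgraph.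
rewrite integral_mkcond fubini_tonelli1; last 2 first.
  apply/(measurable_restrictT _ _).1 => //; apply: measurable_funTS.
  exact: measurableT_comp.
  by move=> u; rewrite patchE; case: ifPn.
rewrite [RHS]integral_mkcond; apply: eq_integral => x _.
rewrite /fubini_F patchE; case: ifPn; last first.
  rewrite notin_setE/= => /negP xab.
  apply: integral0_eq => y _; by rewrite patchE memNset// /E/= => /andP[x_ab]; rewrite x_ab in xab.
rewrite inE/= => xab.
transitivity (\int[mu]_(y in `[0%R, w x[) cst (f x) y).
  rewrite [RHS]integral_mkcond; apply: eq_integral => y _.
  rewrite !patchE; congr (if _ then _ else _).
  by rewrite in_itv/= in xab; apply/idP/idP; rewrite !inE /E/= !in_itv/= xab.
rewrite integral_cst//= lebesgue_measure_itv/= lte_fin oppr0 adde0.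
case: ifPn => //; rewrite -leNgt => wx0; congr (_ * _%:E).
by apply/eqP; rewrite eq_le wx0 w0.
Qed.

Section substitution.
Variables (F w : R -> R) (a b : R).
Hypotheses (ab : (a < b)%R) (Fdecr : {in `[a, b] &, {homo F : x y /~ (x < y)%R}}).
Hypotheses (dF : forall x : R, is_derive x (1%R : R) F (- w x)%R) (cw : continuous w).
Hypothesis w0 : forall x, x \in `]a, b[ -> (0 <= w x)%R.

Let cF : continuous F.
Proof. by move=> x; apply: differentiable_continuous; apply/derivable1_diffP; apply: ex_derive. Qed.

Let integral_w (c : R) : c \in `[a, b] ->
  \int[mu]_(x in `]a, c]) (w x)%:E = (F a - F c)%:E.
Proof.
rewrite in_itv/= => /andP[]; rewrite le_eqVlt => /predU1P[<- _|ac cb].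
  by rewrite set_itvoc0 integral_set0 subrr.
have mw : measurable_fun [set: R] w by exact: continuous_measurable_fun.
rewrite integral_itv_obnd_cbnd; last exact/measurable_EFinP/measurable_funTS.
rewrite (@continuous_FTC2 _ w (\- F)%R)//.
- by rewrite -EFinB/= opprK addrC.
- by apply: continuous_subspaceT.
- split.
  + by move=> x _; apply: derivableN.
  + by apply: cvgN; apply: cvg_at_right_filter; exact: cF.
  + by apply: cvgN; apply: cvg_at_left_filter; exact: cF.
- move=> x _; rewrite derive1E deriveN// derive_val opprK//.
Qed.

(** Since [F] is decreasing, the part of []a, b]] that it sends into a ray [[c, +oo[] is an initial
    interval []a, x1]]. The endpoint is [b] if [c <= F b], [a] if [F a <= c], and otherwise comes
    from the intermediate value theorem. *)
Let ray_preimage (c : R) : exists x1, [/\ x1 \in `[a, b],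
  (forall x, x \in `]a, b] -> (c <= F x)%R = (x <= x1)%R) &
  mu (`[c, +oo[ `&` `]F b, F a[) = (F a - F x1)%:E].
Proof.
have Fle x y : x \in `[a, b] -> y \in `[a, b] -> (F x <= F y)%R = (y <= x)%R.
  exact: (le_nmono_in Fdecr).
have aab : a \in `[a, b] by rewrite in_itv/= lexx ltW.
have bab : b \in `[a, b] by rewrite in_itv/= lexx ltW.
have Fba : (F b < F a)%R by rewrite Fdecr.
have oo_cc x : x \in `]a, b] -> x \in `[a, b] by exact: subset_itv_oc_cc.
have [cFb|Fbc] := leP c (F b).
  exists b; split=> //.
    move=> x xab; have xb : (x <= b)%R by move: xab; rewrite in_itv/= => /andP[].
    by rewrite xb (le_trans cFb)// (Fle _ _ bab (oo_cc _ xab)).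
  rewrite setIidr; last first.
    by move=> y/=; rewrite !in_itv/= andbT => /andP[/ltW + _]; exact: le_trans.
  by rewrite lebesgue_measure_itv/= lte_fin Fba.
have [Fac|cFa] := leP (F a) c.
  exists a; split=> //.
    move=> x xab; have ax : (a < x)%R by move: xab; rewrite in_itv/= => /andP[].
    by rewrite [RHS]leNgt ax leNgt (lt_le_trans _ Fac)// (Fdecr (oo_cc _ xab) aab).
  rewrite subrr (_ : _ `&` _ = set0) ?measure0//.
  apply/seteqP; split=> y//=; rewrite !in_itv/= andbT => -[cy /andP[_ ya]].
  by have := lt_le_trans ya (le_trans Fac cy); rewrite ltxx.
have [||x1 x1ab Fx1] := @IVT _ F a b c (ltW ab).
    exact: continuous_subspaceT.
  by rewrite ge_min le_max (ltW Fbc) (ltW cFa) !orbT.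
exists x1; split=> //.
  by move=> x xab; rewrite -Fx1 Fle// oo_cc.
rewrite (_ : _ `&` _ = `[c, F a[%classic).
  by rewrite lebesgue_measure_itv/= lte_fin cFa Fx1.
apply/seteqP; split=> y/=; rewrite !in_itv/= andbT.
  by move=> [-> /andP[_ ->]].
by move=> /andP[cy ->]; rewrite cy (lt_le_trans Fbc).
Qed.

(** The image under [F] of the measure with density [w] agrees with Lebesgue measure on the rays
    [[c, +oo[] cut down to []F b, F a[]. These rays are stable under intersection and generate the
    Borel sets, so the two measures coincide there and integrate every nonnegative measurable [f]
    alike. *)
Lemma ge0_substitution_decreasing f :
  measurable_fun setT f -> (forall x, 0 <= f x) ->
  \int[mu]_(x in `]a, b[) (f (F x) * (w x)%:E) = \int[mu]_(y in `]F b, F a[) f y.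
Proof.
move=> mf f0.
have mw : measurable_fun [set: R] w by exact: continuous_measurable_fun.
have mF : measurable_fun [set: R] F by exact: continuous_measurable_fun.
pose E (u : R * R) := (u.1 \in `]a, b[) && (0 <= u.2 < w u.1)%R.
have mE : measurable_fun setT E by exact: measurable_fun_subgraph.
(* Off the region under the graph, [phi] takes the value [F b], which is outside the open interval;
   thus the preimage of []F b, F a[] is exactly that region. *)
pose phi (u : R * R) := if E u then F u.1 else F b.
have mphi : measurable_fun setT (phi : measurableTypeR R * measurableTypeR R -> measurableTypeR R).
  apply: measurable_fun_ifT => //.
  exact: measurableT_comp.
have mD : measurable (`]F b, F a[%classic : set R) by [].
have FD x : x \in `]a, b[ -> F x \in `]F b, F a[.
  rewrite !in_itv/= => /andP[ax xb].
  by rewrite !Fdecr// in_itv/= ?lexx ?(ltW ax) ?(ltW xb) ?(ltW ab).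
have phiD : phi @^-1` `]F b, F a[ = [set u | E u].
  apply/seteqP; split=> u /=; rewrite /phi; case: ifPn => //.
    by rewrite in_itv/= ltxx.
  by move=> /andP[/FD].
pose nu : {measure set (measurableTypeR R) -> \bar R} :=
  measure_function_pushforward__canonical__measure_function_Measure (mu \x mu) mphi.
have muphi A : measurable A -> A `<=` `]F b, F a[ ->
    mu A = nu A.
  move=> mA AD.
  (* Restriction to a bounded interval gives the exhausting rays finite measure, as the uniqueness
     theorem requires. *)
  suff : mrestr mu mD A = mrestr nu mD A.
    by rewrite /mrestr setIidl.
  pose m1 : {measure set (measurableTypeR R) -> \bar R} := mrestr mu mD.
  pose m2 : {measure set (measurableTypeR R) -> \bar R} := mrestr nu mD.
  have := @measure_unique _ R (measurableTypeR R) (@RGenCInfty.G R)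
    (fun k : nat => `[(- k%:R)%R, +oo[%classic) _ _ _ _ m1 m2.
  apply => //.
  - exact: RGenCInfty.measurableE.
  - move=> _ _ [x ->] [y ->]; exists (Num.max x y).
    by apply/seteqP; split=> z /=; rewrite !in_itv/= !andbT ge_max => /andP.
  - by move=> k; exists (- k%:R)%R.
  - apply/seteqP; split=> // x _; exists (Num.truncn `|x|).+1 => //=.
    rewrite in_itv/= andbT lerNl (le_trans (ler_norm _))// normrN.
    exact/ltW/truncnS_gt.
  - move=> _ [c ->].
    rewrite /m1 /m2/= /mrestr /nu/= /pushforward preimage_setI phiD.
    have [x1 [x1ab cF1 ->]] : exists x1, [/\ x1 \in `[a, b],
        (forall x, x \in `]a, b] -> (c <= F x)%R = (x <= x1)%R) &
        mu (`[c, +oo[ `&` `]F b, F a[) = (F a - F x1)%:E].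
      exact: ray_preimage.
    have mc : measurable [set x : R | (c <= F x)%R].
      by apply: measurable_setbool; exact: measurable_fun_ler.
    have mc1 : measurable [set u : R * R | (c <= F u.1)%R].
      apply: measurable_setbool; apply: measurable_fun_ler => //.
      exact: measurableT_comp.
    (* By the fundamental theorem of calculus, [F a - F x1] is the integral of [w] over []a, x1]],
       that is, the area under the graph above the points where [c <= F x]. *)
    transitivity (\int[mu \x mu]_(u in [set u | E u]) (\1_[set u : R * R | (c <= F u.1)%R] u)%:E).
      rewrite (@integral_subgraph w (fun x => (\1_[set x : R | (c <= F x)%R] x)%:E))//; last first.
        exact/measurable_EFinP/measurable_indic.
      rewrite integral_itv_bndo_bndc; last first.
        apply: measurable_funTS; apply: emeasurable_funM; last exact/measurable_EFinP.
        exact/measurable_EFinP/measurable_indic.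
      rewrite -integral_w// [LHS]integral_mkcond [RHS]integral_mkcond.
      apply: eq_integral => x _; rewrite !patchE.
      case: ifPn => xax1; case: ifPn => xab //.
      - rewrite indicE mem_set ?mul1e//=; move: xab xax1; rewrite !inE/= => xab.
        by rewrite cF1// in_itv/= => /andP[].
      - move: xax1 xab; rewrite inE notin_setE/= !in_itv/= => /andP[-> xx1].
        by rewrite (le_trans xx1)//; move: x1ab; rewrite in_itv/= => /andP[].
      - rewrite indicE memNset ?mul0e//=; move: xab xax1; rewrite inE notin_setE/= => xab.
        by rewrite cF1// in_itv/=; move: xab; rewrite in_itv/= => /andP[->].
    rewrite integral_indic//; last exact: measurable_setbool.
    congr (_ _); apply/seteqP; split=> u/=.
      move=> [cu Eu]; rewrite in_itv/= andbT /phi Eu; split => //.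
    by move=> [+ Eu]; rewrite in_itv/= andbT /phi Eu.
  - move=> k; rewrite /mrestr; apply: (@le_lt_trans _ _ (mu `]F b, F a[)).
      by apply: le_measure => //; rewrite inE//; exact: measurableI.
    by rewrite lebesgue_measure_itv/=; case: ifPn => _; rewrite ltry.
transitivity (\int[nu]_(y in `]F b, F a[) f y); last first.
  by apply: eq_measure_integral => A mA AD; apply/esym; exact: muphi.
rewrite ge0_integral_pushforward//=; last exact: measurable_funTS.
rewrite phiD -integral_subgraph//; last exact: measurableT_comp.
apply: eq_integral => u; rewrite inE/= => Eu.
by rewrite (_ : phi u = F u.1)// /phi ifT.
Qed.

End substitution.

End integral_lebesgue.

(** * Invariance of Lebesgue measure *)

Section translation.
Local Open Scope ereal_scope.
Context {R : realType}.
Local Notation mu := (@lebesgue_measure R).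
Implicit Types (f : R -> \bar R) (F : R * R -> \bar R) (a b c T : R).

(** Translation preserves the length of half-open intervals, and these lengths determine Lebesgue
    measure. *)
Lemma lebesgue_measure_translate a (A : set R) : measurable A ->
  pushforward mu (fun x => (x + a)%R : measurableTypeR R) A = mu A.
Proof.
have ma : measurable_fun setT (fun x : R => (x + a)%R : measurableTypeR R).
  exact: measurable_funD.
pose nu : {measure set (measurableTypeR R) -> \bar R} :=
  measure_function_pushforward__canonical__measure_function_Measure mu ma.
move=> mA; apply/esym; apply: (@lebesgue_measure_unique _ nu) => //= _ [[u v]] _ <-.
rewrite /nu/= /pushforward (_ : _ @^-1` _ = `](u - a)%R, (v - a)%R]%classic).
  by rewrite !lebesgue_measure_itv/= !lte_fin ltrD2r -!EFinB opprB addrA subrK.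
by apply/seteqP; split=> x/=; rewrite !in_itv/= ltrBlDr lerBrDr.
Qed.

Lemma ge0_integral_translate f a (D : set R) : measurable D ->
  measurable_fun setT f -> (forall x, 0 <= f x) ->
  \int[mu]_(x in [set x | D (x + a)%R]) f (x + a)%R = \int[mu]_(x in D) f x.
Proof.
move=> mD mf f0.
have ma : measurable_fun [set: measurableTypeR R] (fun x : R => (x + a)%R : measurableTypeR R).
  exact: measurable_funD.
have /= <- := @ge0_integral_pushforward _ _ (measurableTypeR R) (measurableTypeR R) R _
  ma mu D f mD.
- by apply: eq_measure_integral => //= A mA AS; exact: lebesgue_measure_translate.
- exact: measurable_funTS.
- by move=> *.
Qed.

Lemma ge0_integral_itv_translate f a b c :
  measurable_fun setT f -> (forall x, 0 <= f x) ->
  \int[mu]_(x in `]a, b[) f (x + c)%R = \int[mu]_(x in `](a + c)%R, (b + c)%R[) f x.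
Proof.
move=> mf f0; rewrite -[RHS](ge0_integral_translate c)//.
rewrite (_ : `]a, b[%classic = [set x | `](a + c)%R, (b + c)%R[%classic (x + c)%R])//.
by apply/seteqP; split=> x/=; rewrite !in_itv/= !ltrD2r.
Qed.

Lemma ge0_integralT_translate f a :
  measurable_fun setT f -> (forall x, 0 <= f x) ->
  \int[mu]_x f (x + a)%R = \int[mu]_x f x.
Proof. by move=> mf f0; rewrite -[RHS](ge0_integral_translate a). Qed.

Lemma ge0_integral_itv_split f a b c : (a <= b)%R -> (b <= c)%R ->
  measurable_fun setT f -> (forall x, 0 <= f x) ->
  \int[mu]_(x in `]a, c[) f x =
  \int[mu]_(x in `]a, b[) f x + \int[mu]_(x in `]b, c[) f x.
Proof.
move=> ab bc mf f0.
rewrite !integral_itv_obnd_cbnd; [|exact: measurable_funTS..].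
rewrite -ge0_integral_setU//=.
- by rewrite -itv_bndbnd_setU// bnd_simp.
- exact: measurable_funTS.
- apply/disj_setPRL => x/=; rewrite !in_itv/= => /andP[bx _]; apply/negP.
  by rewrite negb_and -!leNgt bx orbT.
Qed.

(** The shift is reduced modulo [T] to some [a'] in [[0, T]]. The window []a', T + a'[] is then cut
    at [T], and the piece beyond [T] is moved back onto []0, a'[]. *)
Lemma ge0_integral_periodic f T a : (0 < T)%R ->
  measurable_fun setT f -> (forall x, 0 <= f x) ->
  (forall x, f (x + T)%R = f x) ->
  \int[mu]_(x in `]0%R, T[) f (x + a)%R = \int[mu]_(x in `]0%R, T[) f x.
Proof.
move=> T0 mf f0 fT.
have fTz (k : int) x : f (x + T *~ k)%R = f x.
  have fTn n y : f (y + T *+ n)%R = f y.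
    by elim: n => [|n IH]; rewrite ?mulr0n ?addr0// mulrSr addrA fT.
  case: k => n; first by rewrite -pmulrn.
  by rewrite NegzE mulrNz -pmulrn -[LHS](fTn n.+1) subrK.
have [k [a' [-> a'0 a'T]]] : exists (k : int) a',
    [/\ a = (a' + T *~ k)%R, (0 <= a')%R & (a' <= T)%R].
  exists (Num.floor (a / T)%R), (a - T *~ Num.floor (a / T)%R)%R; split.
  - by rewrite subrK.
  - by rewrite subr_ge0 -mulrzr mulrC -ler_pdivlMr// floor_le_tmp.
  - have : (a / T <= (Num.floor (a / T))%:~R + 1)%R by rewrite -intrD1 ltW// floorD1_gt.
    by rewrite ler_pdivrMr// mulrDl mul1r mulrzl lerBlDr addrC.
under eq_integral do rewrite addrA fTz.
rewrite ge0_integral_itv_translate// add0r.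
rewrite (@ge0_integral_itv_split _ _ T)//; last by rewrite lerDl.
rewrite (@ge0_integral_itv_split _ 0%R a' T)// addeC; congr (_ + _).
rewrite -{1}(add0r T) (addrC T) -ge0_integral_itv_translate//.
by under eq_integral do rewrite fT.
Qed.

Lemma ge0_integral_periodicMn f T n : (0 < T)%R ->
  measurable_fun setT f -> (forall x, 0 <= f x) ->
  (forall x, f (x + T)%R = f x) ->
  \int[mu]_(x in `]0%R, (T *+ n)%R[) f x = n%:R%:E * \int[mu]_(x in `]0%R, T[) f x.
Proof.
move=> T0 mf f0 fT.
have fTn k x : f (x + T *+ k)%R = f x.
  by elim: k => [|k IH]; rewrite ?mulr0n ?addr0// mulrSr addrA fT.
elim: n => [|n IH]; first by rewrite mulr0n set_itvoo0 integral_set0 mul0e.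
rewrite [in LHS]mulrS (@ge0_integral_itv_split _ _ T)//; last 2 first.
  exact: ltW.
  by rewrite lerDl mulrn_wge0// ltW.
rewrite -{2}(add0r T) (addrC T (T *+ n)%R) -ge0_integral_itv_translate//.
by under [X in _ + X]eq_integral do rewrite fT; rewrite IH -nat1r EFinD ge0_muleDl// mul1e.
Qed.

Lemma ge0_integral_shear2 F a : measurable_fun setT F -> (forall u, 0 <= F u) ->
  \int[mu]_x \int[mu]_y F (x, y + a * x)%R = \int[mu]_x \int[mu]_y F (x, y).
Proof.
move=> mF F0; apply: eq_integral => x _.
rewrite (@ge0_integralT_translate (fun y => F (x, y)))//.
exact: measurableT_comp.
Qed.

Lemma ge0_integral_swap F : measurable_fun setT F -> (forall u, 0 <= F u) ->
  \int[mu]_x \int[mu]_y F (x, y) = \int[mu]_y \int[mu]_x F (x, y).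
Proof. by move=> mF F0; exact: fubini_tonelli. Qed.

(** Exchanging the order of integration makes the sheared variable the inner one, where the shear is
    a translation. *)
Lemma ge0_integral_shear1 F a : measurable_fun setT F -> (forall u, 0 <= F u) ->
  \int[mu]_x \int[mu]_y F (x + a * y, y)%R = \int[mu]_x \int[mu]_y F (x, y).
Proof.
move=> mF F0.
have mFa : measurable_fun setT (fun u : R * R => F (u.1 + a * u.2, u.2)%R).
  apply: measurableT_comp => //; apply: measurable_fun_pair => //.
  by apply: measurable_funD => //; exact: measurable_funM.
etransitivity; first exact: (ge0_integral_swap mFa).
rewrite /=.
etransitivity; last by apply/esym; exact: (ge0_integral_swap mF).
apply: eq_integral => y _.
rewrite (@ge0_integralT_translate (fun x => F (x, y)))//.
exact: measurableT_comp.
Qed.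

Lemma ge0_integral_rotation F a b : measurable_fun setT F -> (forall u, 0 <= F u) ->
  (a ^+ 2 + b ^+ 2 = 1)%R ->
  \int[mu]_x \int[mu]_y F (a * x + b * y, - b * x + a * y)%R =
  \int[mu]_x \int[mu]_y F (x, y).
Proof.
have rot G c s : s != 0%R -> (c ^+ 2 + s ^+ 2 = 1)%R ->
    measurable_fun setT G -> (forall u, 0 <= G u) ->
    \int[mu]_x \int[mu]_y G (c * x + s * y, - s * x + c * y)%R =
    \int[mu]_x \int[mu]_y G (x, y).
  (* [[c,s],[-s,c]] = [[1,t],[0,1]] [[1,0],[-s,1]] [[1,t],[0,1]] with t = (1 - c) / s. *)
  move=> s0 cs mG G0; pose t := ((1 - c) / s)%R.
  pose G1 (u : R * R) := G (u.1 + t * u.2, u.2)%R.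
  have mG1 : measurable_fun setT G1.
    apply: measurableT_comp => //; apply: measurable_fun_pair => //.
    by apply: measurable_funD => //; exact: measurable_funM.
  pose G2 (u : R * R) := G1 (u.1, u.2 + - s * u.1)%R.
  have mG2 : measurable_fun setT G2.
    apply: measurableT_comp => //; apply: measurable_fun_pair => //.
    by apply: measurable_funD => //; exact: measurable_funM.
  have G10 u : 0 <= G1 u by exact: G0.
  have G20 u : 0 <= G2 u by exact: G0.
  transitivity (\int[mu]_x \int[mu]_y G2 (x + t * y, y)%R); last first.
    rewrite (ge0_integral_shear1 t mG2 G20) (ge0_integral_shear2 (- s)%R mG1 G10).
    exact: (ge0_integral_shear1 t mG G0).
  apply: eq_integral => x _; apply: eq_integral => y _.
  rewrite /G2 /G1/=; congr (G (_, _)); rewrite /t.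
    (* The last term is zero because [c ^+ 2 + s ^+ 2 = 1]; with it included, the identity holds for
       all [c] and all nonzero [s]. *)
    have -> : (c * x + s * y = x + (1 - c) / s * y + (1 - c) / s * (y - s * (x + (1 - c) / s * y)) -
      (1 - c ^+ 2 - s ^+ 2) * y / s)%R by field.
    by rewrite -(addrA 1%R) -opprD cs; ring.
  by field.
move=> mF F0 ab; have [b0|b0] := eqVneq b 0%R; last exact: rot.
move: ab; rewrite b0 expr0n/= addr0 => /eqP; rewrite sqrf_eq1 => /predU1P[->|/eqP->].
  apply: eq_integral => x _; apply: eq_integral => y _.
  by congr (F (_, _)); ring.
(* The half turn [a = -1], [b = 0] has no shear factorization of the above form. It is the
   composition of two quarter turns, both with [s = 1]. *)
pose G (u : R * R) := F (u.2, - u.1)%R.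
have mG : measurable_fun setT G.
  apply: measurableT_comp => //; apply: measurable_fun_pair => //.
  exact: measurable_funN.
have := @rot F 0%R 1%R (oner_neq0 _); rewrite expr0n expr1n add0r => /(_ erefl mF F0) <-.
have := @rot G 0%R 1%R (oner_neq0 _); rewrite expr0n expr1n add0r => /(_ erefl mG).
rewrite /G/= => H.
transitivity (\int[mu]_x \int[mu]_y F (- 1 * x + 0 * y, - (0 * x + 1 * y))%R).
  apply: eq_integral => x _; apply: eq_integral => y _.
  by congr (F (_, _)); ring.
refine (eq_trans (H (fun=> F0 _)) _).
apply: eq_integral => x _; apply: eq_integral => y _.
by congr (F (_, _)); ring.
Qed.

End translation.

(** * Archimedes' theorem *)

Section archimedes.
Local Open Scope ereal_scope.
Context {R : realType}.
Local Notation mu := (@lebesgue_measure R).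
Implicit Types (f g : R -> \bar R) (a b : R).

(** The inverse is not continuous at [0]; it is treated as the real power of exponent [-1], with
    which it agrees on nonnegative numbers. *)
Lemma measurable_invsqrt d (T : measurableType d) (h : T -> R) :
  measurable_fun setT h -> measurable_fun setT (fun x => (Num.sqrt (h x))^-1%R).
Proof.
move=> mh; under eq_fun do rewrite -powR_inv1//.
have msqrt : measurable_fun setT (fun x => Num.sqrt (h x)).
  by apply: measurableT_comp => //; exact: measurable_sqrt.
exact: (measurableT_comp (@measurable_powR R (-1)%R) msqrt).
Qed.

(** Substitution [y = r * cos x]: on []0, pi[] the square root equals [r * sin x] and cancels the
    Jacobian. The right side can run over the whole line because the density, as encoded, is [0]
    where [r <= |y|]. *)
Lemma ge0_integral_arcsine g (r : R) : (0 < r)%R ->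
  measurable_fun setT g -> (forall x, 0 <= g x) ->
  \int[mu]_(x in `]0%R, pi[) g (r * cos x)%R =
  \int[mu]_y (g y * ((Num.sqrt (r ^+ 2 - y ^+ 2))^-1)%:E).
Proof.
move=> r0 mg g0.
pose f y := g y * ((Num.sqrt (r ^+ 2 - y ^+ 2))^-1)%:E.
have mf : measurable_fun setT f.
  apply: emeasurable_funM => //; apply/measurable_EFinP.
  by apply: measurable_invsqrt; apply: measurable_funB => //; exact: measurable_funX.
have f0 y : 0 <= f y by rewrite mule_ge0// lee_fin invr_ge0 sqrtr_ge0.
have decr : {in `[0%R, pi] &, {homo (fun x => r * cos x)%R : x y /~ (x < y)%R}}.
  by move=> x y xpi ypi xy; rewrite ltr_pM2l// ltr_cos.
have drcos x : is_derive x (1%R : R) (fun x => r * cos x)%R (- (r * sin x))%R.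
  rewrite (_ : (fun x => r * cos x)%R = (r *: cos)%R)//.
  by apply: is_derive_eq; rewrite scalerN.
have crsin : continuous (fun x => r * sin x)%R.
  by move=> x; apply: cvgM; [exact: cvg_cst|exact: continuous_sin].
have rsin0 (x : R) : x \in `]0%R, pi[ -> (0 <= r * sin x)%R.
  by rewrite in_itv/= => x0pi; rewrite mulr_ge0 ?(ltW r0)// ltW// sin_gt0_pi.
transitivity (\int[mu]_(x in `]0%R, pi[) (f (r * cos x)%R * (r * sin x)%:E)).
  apply: eq_integral => x; rewrite inE/= in_itv/= => x0pi.
  have sx : (0 < sin x)%R by exact: sin_gt0_pi.
  rewrite /f -muleA -EFinM (_ : Num.sqrt _ = (r * sin x)%R).
    by rewrite mulVf ?mule1// mulf_neq0// gt_eqF.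
  rewrite exprMn -{1}(mulr1 (r ^+ 2)%R) -mulrBr -sin2cos2 -exprMn sqrtr_sqr.
  by rewrite ger0_norm// mulr_ge0// ltW.
rewrite (ge0_substitution_decreasing (@pi_gt0 R) decr drcos crsin rsin0 mf f0).
rewrite cos0 cospi mulr1 mulrN1 [LHS]integral_mkcond; apply: eq_integral => y _.
rewrite patchE; case: ifPn => //; rewrite notin_setE/= in_itv/= => /negP yr.
rewrite /f ler0_sqrtr ?invr0 ?mule0// subr_le0 -ler_sqrt ?sqr_ge0//.
rewrite !sqrtr_sqr (ger0_norm (ltW r0)) leNgt; apply: contra yr.
by rewrite ltr_norml.
Qed.

(** Substitution [z = cos (2 * x)], for which [dz = - 4 cos x sin x dx]. Here [z] is the height on
    the 2-sphere of the Hopf image of a point with first coordinate [x]. *)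
Lemma ge0_integral_cos2 f : measurable_fun setT f -> (forall x, 0 <= f x) ->
  \int[mu]_(x in `]0%R, (pi / 2)%R[) (f (cos (2 * x))%R * (cos x * sin x)%:E) =
  (4^-1)%:E * \int[mu]_(z in `](-1)%R, 1%R[) f z.
Proof.
move=> mf f0.
have mf4 : measurable_fun setT (fun x => (4^-1)%:E * f x) by exact: emeasurable_funM.
have f40 x : 0 <= (4^-1)%:E * f x by rewrite mule_ge0.
have pi0 := @pi_gt0 R.
have pi20 : (0 < pi / 2 :> R)%R by rewrite divr_gt0.
have decr : {in `[0%R, (pi / 2)%R] &, {homo (fun x : R => cos (2 * x))%R : x y /~ (x < y)%R}}.
  move=> x y xI yI xy; move: xI yI.
  rewrite !in_itv/= => /andP[x0 xpi] /andP[y0 ypi].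
  by rewrite ltr_cos ?in_itv/= ?ltr_pM2l// mulr_ge0//= mulrC -ler_pdivlMr.
have dcos2 x : is_derive x (1%R : R) (fun x : R => cos (2 * x))%R (- (4 * (cos x * sin x)))%R.
  have d2 : is_derive x (1%R : R) (fun x : R => 2 * x)%R 2%R.
    rewrite (_ : (fun x : R => 2 * x)%R = ((2%R : R) *: id)%R)//.
    by apply: is_derive_eq; rewrite /GRing.scale/= mulr1.
  rewrite (_ : (- (4 * (cos x * sin x)) = - sin (2 * x) * 2)%R).
    exact: (is_derive1_comp (is_derive_cos _) d2).
  by rewrite (mulr_natl x 2) sin_mulr2n; ring.
have csin2 : continuous (fun x : R => 4 * (cos x * sin x))%R.
  move=> x; apply: cvgM; first exact: cvg_cst.
  by apply: cvgM; [exact: continuous_cos|exact: continuous_sin].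
have sin20 (x : R) : x \in `]0%R, (pi / 2)%R[ -> (0 <= 4 * (cos x * sin x))%R.
  by move=> /mul_cos_sin_ge0 cs0; rewrite mulr_ge0.
transitivity (\int[mu]_(x in `]0%R, (pi / 2)%R[)
    (((4^-1)%:E * f (cos (2 * x))%R) * (4 * (cos x * sin x))%:E)).
  apply: eq_integral => x _.
  rewrite [X in _ = X * _]muleC -muleA -EFinM; congr (_ * _%:E).
  by field.
rewrite (ge0_substitution_decreasing pi20 decr dcos2 csin2 sin20 mf4 f40).
rewrite mulr0 cos0 mulrC divfK// cospi ge0_integralZl_EFin//.
exact: measurable_funTS.
Qed.

(* Outside the unit disc the density is [0], because [Num.sqrt] of a negative number
   and the inverse of [0] are both [0]. *)
Lemma cap_integralE g a b : measurable_fun setT g -> (forall x, 0 <= g x) ->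
  \int[mu]_(z in `](-1)%R, 1%R[) \int[mu]_(x in `]0%R, pi[)
    g (a * z + b * (Num.sqrt (1 - z ^+ 2) * cos x))%R =
  \int[mu]_z \int[mu]_y
    (g (a * z + b * y)%R * ((Num.sqrt (1 - (z ^+ 2 + y ^+ 2)))^-1)%:E).
Proof.
move=> mg g0; rewrite integral_mkcond; apply: eq_integral => z _.
rewrite patchE; case: ifPn.
  rewrite inE/= in_itv/= -ltr_norml => z1.
  have z2 : (0 < 1 - z ^+ 2)%R by rewrite subr_gt0 -real_normK ?num_real// expr_lt1.
  have := @ge0_integral_arcsine (fun y => g (a * z + b * y)%R) (Num.sqrt (1 - z ^+ 2)).
  rewrite sqrtr_gt0 => ->//.
    by apply: eq_integral => y _; rewrite sqr_sqrtr ?ltW// opprD addrA.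
  apply: measurableT_comp => //; apply: measurable_funD => //; exact: measurable_funM.
rewrite notin_setE/= in_itv/= -ltr_norml => /negP; rewrite -leNgt => z1.
apply/esym/integral0_eq => y _; rewrite ler0_sqrtr ?invr0 ?mule0//.
rewrite subr_le0 ler_wpDr ?sqr_ge0// -real_normK ?num_real//.
by rewrite -[X in (X <= _)%R](expr1n _ 2) lerXn2r ?nnegrE.
Qed.

(** Read [2 * x] as polar angle and [y] as azimuth on half of the unit 2-sphere: the argument of [g]
    is the height along an axis tilted by [(a, b)]. Projected to a plane containing the axis, the
    area has a rotation invariant density, so the axis can be made vertical. The azimuth then
    contributes [pi], and the substitution in [x] contributes [1 / 4]. *)
Lemma ge0_integral_archimedes g a b : measurable_fun setT g -> (forall x, 0 <= g x) ->
  (a ^+ 2 + b ^+ 2 = 1)%R ->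
  \int[mu]_(x in `]0%R, (pi / 2)%R[)
    ((\int[mu]_(y in `]0%R, pi[) g (a * cos (2 * x) + b * (sin (2 * x) * cos y))%R) *
     (cos x * sin x)%:E) =
  (pi / 4)%:E * \int[mu]_(z in `](-1)%R, 1%R[) g z.
Proof.
move=> mg g0 ab.
pose J a b z := \int[mu]_(y in `]0%R, pi[) g (a * z + b * (Num.sqrt (1 - z ^+ 2) * cos y))%R.
have mJ : measurable_fun setT (J a b).
  apply: (@measurable_ge0_integral2 _ _ _ _ R mu
    (fun u : R * R => g (a * u.1 + b * (Num.sqrt (1 - u.1 ^+ 2) * cos u.2))%R)) => //.
  apply: measurableT_comp => //; apply: measurable_funD => //; first exact: measurable_funM.
  apply: measurable_funM => //; apply: measurable_funM.
    apply: measurableT_comp; first exact: measurable_sqrt.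
    by apply: measurable_funB => //; exact: measurable_funX.
  apply: measurableT_comp => //; exact: measurable_cos.
have J0 z : 0 <= J a b z by exact: integral_ge0.
transitivity (\int[mu]_(x in `]0%R, (pi / 2)%R[) (J a b (cos (2 * x))%R * (cos x * sin x)%:E)).
  apply: eq_integral => x; rewrite inE/= in_itv/= => /andP[x0 xpi]; congr (_ * _).
  rewrite /J -sin2cos2 sqrtr_sqr ger0_norm// sin_ge0_pi// mulr_ge0 ?ltW//=.
  by rewrite mulrC -ltr_pdivlMr.
rewrite ge0_integral_cos2// /J cap_integralE//.
pose G (u : R * R) := g u.1 * ((Num.sqrt (1 - (u.1 ^+ 2 + u.2 ^+ 2)))^-1)%:E.
have mG : measurable_fun setT G.
  apply: emeasurable_funM; first exact: measurableT_comp.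
  apply/measurable_EFinP; apply: measurable_invsqrt; apply: measurable_funB => //.
  by apply: measurable_funD; apply: measurable_funX.
have G0 u : 0 <= G u by rewrite mule_ge0// lee_fin invr_ge0 sqrtr_ge0.
(* The density depends only on [z ^+ 2 + y ^+ 2], so it can be evaluated at the rotated point. *)
transitivity ((4^-1)%:E * \int[mu]_z \int[mu]_y G (a * z + b * y, - b * z + a * y)%R).
  apply: (congr1 (fun e => (4^-1)%:E * e)); apply: eq_integral => z _; apply: eq_integral => y _.
  have zy (u v : R) : ((a * u + b * v) ^+ 2 + (- b * u + a * v) ^+ 2 = u ^+ 2 + v ^+ 2)%R.
    by rewrite -[RHS]mul1r -ab; ring.
  by rewrite /G/= zy.
rewrite (ge0_integral_rotation mG G0 ab).
(* Back to angles with the vertical axis, where the integrand no longer depends on the azimuth. *)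
transitivity ((4^-1)%:E * \int[mu]_(z in `](-1)%R, 1%R[) J 1%R 0%R z).
  apply: (congr1 (fun e => (4^-1)%:E * e)); apply/esym.
  refine (eq_trans (cap_integralE 1%R 0%R mg g0) _).
  apply: eq_integral => z _; apply: eq_integral => y _.
  by rewrite mul1r mul0r addr0.
transitivity ((4^-1)%:E * \int[mu]_(z in `](-1)%R, 1%R[) (pi%:E * g z)).
  apply: (congr1 (fun e => (4^-1)%:E * e)); apply: eq_integral => z _; rewrite /J.
  under eq_integral do rewrite mul1r mul0r addr0.
  by rewrite integral_cst//= lebesgue_measure_itv/= lte_fin pi_gt0 oppr0 adde0 muleC.
rewrite ge0_integralZl_EFin ?pi_ge0//; last exact: measurable_funTS.
by rewrite muleA -EFinM mulrC.
Qed.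

End archimedes.

(** * The law of the Hermitian product *)

Section hopf_integral.
Local Open Scope ereal_scope.
Context {R : realType}.
Local Notation mu := (@lebesgue_measure R).
Implicit Types (g : R -> \bar R) (a b c d : R).

Lemma ge0_integral_swap_on (F : R * R -> \bar R) (A B : set R) :
  measurable A -> measurable B ->
  measurable_fun setT F -> (forall u, 0 <= F u) ->
  \int[mu]_(x in A) \int[mu]_(y in B) F (x, y) =
  \int[mu]_(y in B) \int[mu]_(x in A) F (x, y).
Proof.
move=> mA mB mF F0.
have mFAB : measurable_fun setT (F \_ (A `*` B)).
  by apply/(measurable_restrictT _ _).1; [exact: measurableX|exact: measurable_funTS].
have FAB0 u : 0 <= (F \_ (A `*` B)) u by rewrite patchE; case: ifPn.
transitivity (\int[mu]_x \int[mu]_y (F \_ (A `*` B)) (x, y)).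
  rewrite integral_mkcond; apply: eq_integral => x _; rewrite patchE; case: ifPn => xA.
    rewrite integral_mkcond; apply: eq_integral => y _.
    by rewrite !patchE in_setX xA.
  by apply/esym/integral0_eq => y _; rewrite patchE in_setX (negbTE xA).
etransitivity; first exact: ge0_integral_swap.
rewrite [RHS]integral_mkcond; apply: eq_integral => y _; rewrite patchE; case: ifPn => yB.
  rewrite [RHS]integral_mkcond; apply: eq_integral => x _.
  by rewrite !patchE in_setX yB andbT.
by apply/integral0_eq => x _; rewrite patchE in_setX (negbTE yB) andbF.
Qed.

(** The angle is [acos (u / W)] up to the sign of [v]; the zero vector is given angle [0]. *)
Lemma polar_decomposition (u v : R) : exists W t : R,
  [/\ (0 <= W)%R, (W ^+ 2 = u ^+ 2 + v ^+ 2)%R, u = (W * cos t)%R & v = (W * sin t)%R].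
Proof.
pose W : R := Num.sqrt (u ^+ 2 + v ^+ 2); have W0 : (0 <= W)%R by exact: sqrtr_ge0.
have W2 : (W ^+ 2 = u ^+ 2 + v ^+ 2)%R by rewrite sqr_sqrtr// addr_ge0// sqr_ge0.
have [We0|Wn0] := eqVneq W 0%R.
  exists 0%R, 0%R; move: W2; rewrite We0 expr0n/= => /esym/eqP.
  rewrite paddr_eq0 ?sqr_ge0// !sqrf_eq0 => /andP[/eqP-> /eqP->].
  by rewrite expr0n !mul0r addr0; split.
have W_gt0 : (0 < W)%R by rewrite lt0r Wn0.
have uW : (-1 <= u / W <= 1)%R.
  rewrite -ler_norml normrM normfV (gtr0_norm W_gt0) ler_pdivrMr// mul1r.
  rewrite -(ger0_norm W0) -ler_sqr ?nnegrE//.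
  by rewrite !real_normK ?num_real// W2 lerDl sqr_ge0.
have sW : (W * sin (acos (u / W)) = `|v|)%R.
  rewrite sin_acos// -{1}(ger0_norm W0) -sqrtr_sqr -sqrtrM ?sqr_ge0//.
  rewrite mulrBr mulr1 -exprMn mulrC divfK//.
  by rewrite W2 addrC addKr sqrtr_sqr.
have cW : (W * cos (acos (u / W)) = u)%R by rewrite acosK ?in_itv// mulrC divfK.
have [v0|v0] := leP 0%R v.
  by exists W, (acos (u / W)); split=> //; rewrite sW ger0_norm.
by exists W, (- acos (u / W))%R; split=> //; rewrite ?cosN// sinN mulrN sW ltr0_norm// opprK.
Qed.

Lemma cos_2piD (x : R) : cos (x + 2 * pi) = cos x.
Proof. by rewrite mulr_natl cosD2pi. Qed.

Lemma sin_2piD (x : R) : sin (x + 2 * pi) = sin x.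
Proof. by rewrite mulr_natl sinD2pi. Qed.

(** The second half of the circle is shifted back by [pi], which changes the sign of the cosine.
    This reduces to []0, pi[], where the cosine is a legitimate substitution. *)
Lemma ge0_integral_cos_fold g c d : measurable_fun setT g -> (forall x, 0 <= g x) ->
  \int[mu]_(y in `]0%R, (2 * pi)%R[) g (c + d * cos y)%R =
  \int[mu]_(y in `]0%R, pi[) g (c + d * cos y)%R +
  \int[mu]_(y in `]0%R, pi[) g (c + - d * cos y)%R.
Proof.
move=> mg g0.
have mgc : measurable_fun setT (fun y => g (c + d * cos y)%R).
  apply: measurableT_comp => //; apply: measurable_funD => //.
  by apply: measurable_funM => //; exact: measurable_cos.
have pi0 := @pi_gt0 R.
rewrite (@ge0_integral_itv_split _ _ _ pi)//; [|lra..].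
congr (_ + _); rewrite (_ : `]pi, (2 * pi)%R[ = `](0 + pi)%R, (pi + pi)%R[); last first.
  by rewrite add0r mulr_natl mulr2n.
rewrite -(ge0_integral_itv_translate _ _ _ mgc)//; apply: eq_integral => y _.
by rewrite cosDpi mulrN mulNr.
Qed.

Variable G : R * R -> \bar R.
Hypotheses (mG : measurable_fun setT G) (G0 : forall u, 0 <= G u).

(** The parameter is the squared radius, because that is the quantity which turns out to be
    uniformly distributed. *)
Definition circle_integral (s : R) : \bar R :=
  \int[mu]_(x in `]0%R, (2 * pi)%R[) G (Num.sqrt s * cos x, Num.sqrt s * sin x)%R.

Lemma circle_integral_ge0 s : 0 <= circle_integral s.
Proof. exact: integral_ge0. Qed.

Let mcos := @measurable_cos R.
Let msin := @measurable_sin R.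
Let msqrt := @measurable_sqrt R.

Lemma measurable_circle_integral : measurable_fun setT circle_integral.
Proof.
apply: (@measurable_ge0_integral2 _ _ _ _ R mu
  (fun u : R * R => G (Num.sqrt u.1 * cos u.2, Num.sqrt u.1 * sin u.2)%R)) => //.
apply: measurableT_comp => //.
apply: measurable_fun_pair; apply: measurable_funM; exact: measurableT_comp.
Qed.

(** By periodicity the second angle can be measured from the first, which absorbs [a] and [b]. For a
    fixed difference [y], the sum of the two vectors then turns rigidly with [x] and describes a
    circle, whose squared radius is given by the law of cosines. *)
Lemma ge0_integral_torus (P Q a b : R) :
  \int[mu]_(x in `]0%R, (2 * pi)%R[) \int[mu]_(y in `]0%R, (2 * pi)%R[)
    G (P * cos (x + a) + Q * cos (y + b), P * sin (x + a) + Q * sin (y + b))%R =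
  \int[mu]_(y in `]0%R, (2 * pi)%R[)
    circle_integral (P ^+ 2 + Q ^+ 2 + 2 * P * Q * cos y).
Proof.
pose H (u : R * R) := G (P * cos u.1 + Q * cos u.2, P * sin u.1 + Q * sin u.2)%R.
have mH : measurable_fun setT H.
  apply: measurableT_comp => //.
  by apply: measurable_fun_pair; apply: measurable_funD; apply: measurable_funM => //;
    exact: measurableT_comp.
have H0 u : 0 <= H u by exact: G0.
have pi2 : (0 < 2 * pi :> R)%R by rewrite mulr_gt0// pi_gt0.
have HTr x y : H (x, y + 2 * pi)%R = H (x, y) by rewrite /H/= cos_2piD sin_2piD.
have HTl x y : H (x + 2 * pi, y)%R = H (x, y) by rewrite /H/= cos_2piD sin_2piD.
have mHx x : measurable_fun setT (fun y => H (x, y)) by exact: measurableT_comp.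
have mHd : measurable_fun setT (fun u : R * R => H (u.1, u.2 + u.1)%R).
  apply: measurableT_comp => //; apply: measurable_fun_pair => //.
  exact: measurable_funD.
transitivity (\int[mu]_(x in `]0%R, (2 * pi)%R[) \int[mu]_(y in `]0%R, (2 * pi)%R[)
    H (x + a, y + (x + a))%R).
  apply: eq_integral => x _.
  rewrite [RHS](@ge0_integral_periodic R (fun y => H (x + a, y)%R))//.
  exact: (@ge0_integral_periodic R (fun y => H (x + a, y)%R)).
etransitivity.
  apply: (ge0_integral_swap_on (F := fun u : R * R => H (u.1 + a, u.2 + (u.1 + a))%R)) => //.
  apply: measurableT_comp => //; apply: measurable_fun_pair.
    exact: measurable_funD.
  by apply: measurable_funD => //; exact: measurable_funD.
apply: eq_integral => y _ /=.
rewrite (@ge0_integral_periodic R (fun x => H (x, y + x)%R))//; last 2 first.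
  exact: (measurableT_comp mHd (measurable_pair2 y)).
  by move=> x; rewrite addrA HTl HTr.
(* The sum before turning is [P + Q e^(iy) = W e^(it)]. Its phase [t] only shifts the angle [x], so
   it disappears by periodicity. *)
have [W [t [W0 W2 cW sW]]] := polar_decomposition (P + Q * cos y) (Q * sin y).
have -> : (P ^+ 2 + Q ^+ 2 + 2 * P * Q * cos y = W ^+ 2)%R.
  rewrite W2 -[X in (_ + X + _)%R]mulr1 -[X in (_ + _ * X + _)%R](cos2Dsin2 y); ring.
rewrite /circle_integral sqrtr_sqr (ger0_norm W0).
have mW : measurable_fun setT (fun x => G (W * cos x, W * sin x)%R).
  by apply: measurableT_comp => //; apply: measurable_fun_pair; apply: measurable_funM.
rewrite -(@ge0_integral_periodic R (fun x => G (W * cos x, W * sin x)%R) (2 * pi) t)//; last first.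
  by move=> x; rewrite cos_2piD sin_2piD.
apply: eq_integral => x _; rewrite /H/=; congr (G (_, _)).
  rewrite !cosD; transitivity (cos x * (P + Q * cos y) - sin x * (Q * sin y))%R; first ring.
  by rewrite cW sW; ring.
rewrite !sinD; transitivity (sin x * (P + Q * cos y) + cos x * (Q * sin y))%R; first ring.
by rewrite cW sW; ring.
Qed.

(** For fixed [t], the torus integral depends on the angle difference only through its cosine. Its
    two half circles correspond to axes tilted by [(A, B)] and [(A, - B)], and Archimedes' theorem
    gives [pi / 4] for each. *)
Lemma ge0_integral_hopf (C S a b : R) : (C ^+ 2 + S ^+ 2 = 1)%R ->
  \int[mu]_(t in `]0%R, (pi / 2)%R[)
   \int[mu]_(x in `]0%R, (2 * pi)%R[) \int[mu]_(y in `]0%R, (2 * pi)%R[)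
   (G ((cos t * C) * cos (x + a) + (sin t * S) * cos (y + b),
      (cos t * C) * sin (x + a) + (sin t * S) * sin (y + b))%R * (cos t * sin t)%:E) =
  (pi / 2)%:E * \int[mu]_(z in `](-1)%R, 1%R[) circle_integral ((1 + z) / 2).
Proof.
move=> CS.
pose g z := circle_integral ((1 + z) / 2).
have g0 z : 0 <= g z by exact: circle_integral_ge0.
have mg : measurable_fun setT g.
  apply: measurableT_comp; first exact: measurable_circle_integral.
  by apply: measurable_funM => //; exact: measurable_funD.
(* [|h|^2 = (1 + A cos 2t + B sin 2t cos y) / 2], where [y] is the angle difference. *)
pose A := (C ^+ 2 - S ^+ 2)%R; pose B := (2 * C * S)%R.
have AB : (A ^+ 2 + B ^+ 2 = 1)%R.
  transitivity ((C ^+ 2 + S ^+ 2) ^+ 2)%R; first by rewrite /A /B; ring.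
  by rewrite CS expr1n.
have AB' : (A ^+ 2 + (- B) ^+ 2 = 1)%R by rewrite sqrrN.
pose L b x := \int[mu]_(y in `]0%R, pi[) g (A * cos (2 * x) + b * (sin (2 * x) * cos y))%R.
have L0 b' x : 0 <= L b' x by exact: integral_ge0.
have mL b' : measurable_fun setT (L b').
  apply: (@measurable_ge0_integral2 _ _ _ _ R mu
    (fun u : R * R => g (A * cos (2 * u.1) + b' * (sin (2 * u.1) * cos u.2))%R)) => //.
  apply: measurableT_comp => //; apply: measurable_funD; apply: measurable_funM => //.
    by apply: measurableT_comp => //; exact: measurable_funM.
  apply: measurable_funM; last exact: measurableT_comp.
  by apply: measurableT_comp => //; exact: measurable_funM.
have mcs : measurable_fun setT (fun x : R => (cos x * sin x)%:E).
  by apply/measurable_EFinP; exact: measurable_funM.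
have cs0 (x : R) : x \in `]0%R, (pi / 2)%R[ -> 0 <= (cos x * sin x)%:E.
  by move=> /mul_cos_sin_ge0; rewrite lee_fin.
transitivity (\int[mu]_(t in `]0%R, (pi / 2)%R[)
    (L B t * (cos t * sin t)%:E + L (- B)%R t * (cos t * sin t)%:E)).
  apply: eq_integral => t; rewrite inE/= => t0; have cst0 := cs0 _ t0.
  rewrite -ge0_muleDl//.
  pose G' (u : R * R) := G ((cos t * C) * cos (u.1 + a) + (sin t * S) * cos (u.2 + b),
      (cos t * C) * sin (u.1 + a) + (sin t * S) * sin (u.2 + b))%R.
  have mG' : measurable_fun setT G'.
    apply: measurableT_comp => //.
    by apply: measurable_fun_pair; apply: measurable_funD; apply: measurable_funM => //;
      apply: measurableT_comp => //; exact: measurable_funD.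
  have G0' u : 0 <= G' u by exact: G0.
  transitivity ((\int[mu]_(x in `]0%R, (2 * pi)%R[) \int[mu]_(y in `]0%R, (2 * pi)%R[) G' (x, y))
      * (cos t * sin t)%:E).
    rewrite -ge0_integralZr//; last 2 first.
      by apply: measurable_funTS; apply: (@measurable_ge0_integral2 _ _ _ _ R mu G').
      by move=> x _; apply: integral_ge0 => y _; exact: G0'.
    apply: eq_integral => x _; rewrite -[RHS]ge0_integralZr//.
    by apply: measurable_funTS; exact: (measurableT_comp mG').
  congr (_ * _); rewrite /G'/= ge0_integral_torus.
  rewrite /L -[X in _ + X](_ : \int[mu]_(y in `]0%R, pi[)
      g (A * cos (2 * t) + - (B * sin (2 * t)) * cos y)%R = _); last first.
    by apply: eq_integral => y _; rewrite mulNr mulNr mulrA.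
  rewrite -[X in X + _](_ : \int[mu]_(y in `]0%R, pi[)
      g (A * cos (2 * t) + (B * sin (2 * t)) * cos y)%R = _); last first.
    by apply: eq_integral => y _; rewrite mulrA.
  etransitivity; last first.
    exact: (ge0_integral_cos_fold (A * cos (2 * t))%R (B * sin (2 * t))%R mg g0).
  apply: eq_integral => y _; apply: (congr1 circle_integral).
  rewrite /A /B !(mulr_natl t 2) cos_mulr2n sin_mulr2n -[X in ((X + _) / _)%R]CS.
  have -> : ((sin t * S) ^+ 2 = S ^+ 2 - cos t ^+ 2 * S ^+ 2)%R by rewrite exprMn sin2cos2; ring.
  by field.
have LE b' : (A ^+ 2 + b' ^+ 2 = 1)%R ->
    \int[mu]_(t in `]0%R, (pi / 2)%R[) (L b' t * (cos t * sin t)%:E) =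
    (pi / 4)%:E * \int[mu]_(z in `](-1)%R, 1%R[) g z.
  exact: ge0_integral_archimedes mg g0.
have mLcs b' : measurable_fun setT (fun t => L b' t * (cos t * sin t)%:E).
  exact: emeasurable_funM (mL b') mcs.
have Lcs0 b' (t : R) : t \in `]0%R, (pi / 2)%R[ -> 0 <= L b' t * (cos t * sin t)%:E.
  by move=> t0; rewrite mule_ge0// cs0.
rewrite ge0_integralD//; try exact: Lcs0; last 2 first.
- exact: (measurable_funTS (mLcs B)).
- exact: (measurable_funTS (mLcs (- B)%R)).
refine (eq_trans (congr2 (fun x y : \bar R => x + y) (LE _ AB) (LE _ AB')) _).
rewrite -ge0_muleDl ?lee_fin ?divr_ge0 ?pi_ge0//.
by congr (_ * _); rewrite -EFinD; congr EFin; field.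
Qed.

End hopf_integral.

(** * The disc covered by n caps *)

Section caps.
Context {R : realType}.
Local Notation mu := (@lebesgue_measure R).
Implicit Types (x s c r t : R) (n k : nat).

(* [h] is read as the complex number [h.1 + i h.2]: [Re (w h) >= c] for some [n]th root
   of unity [w]. *)
Definition in_caps n c (h : R * R) : bool :=
  has (fun k => c <= h.1 * cos (k%:R * (2 * pi / n%:R)) - h.2 * sin (k%:R * (2 * pi / n%:R)))
    (iota 0 n).

Definition caps_indic n c (h : R * R) : \bar R := (\1_[set h | in_caps n c h] h)%:E.

Lemma measurable_has d (T : measurableType d) (p : nat -> T -> bool) (s : seq nat) :
  (forall k, measurable_fun setT (p k)) ->
  measurable_fun setT (fun w => has (fun k => p k w) s).
Proof.
move=> mp; elim: s => [|k s IH]/=; first exact: measurable_cst.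
exact: measurable_or.
Qed.

Lemma measurable_in_caps n c : measurable [set h : R * R | in_caps n c h].
Proof.
apply: measurable_setbool; apply: measurable_has => k.
apply: measurable_fun_ler => //; apply: measurable_funB; exact: measurable_funM.
Qed.

Lemma measurable_caps_indic n c : measurable_fun setT (caps_indic n c).
Proof. by apply/measurable_EFinP; apply: measurable_indic; exact: measurable_in_caps. Qed.

Lemma caps_indicE n c h : caps_indic n c h = ((in_caps n c h)%:R)%:E.
Proof.
rewrite /caps_indic indicE (_ : (h \in _) = in_caps n c h)//.
by apply/idP/idP; rewrite inE.
Qed.

Lemma caps_indic_ge0 n c h : (0 <= caps_indic n c h)%E.
Proof. by rewrite caps_indicE lee_fin ler0n. Qed.

Lemma in_caps_polarP n c s x :
  reflect (exists2 k, (k < n)%N & c <= s * cos (x + k%:R * (2 * pi / n%:R)))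
    (in_caps n c (s * cos x, s * sin x)).
Proof.
have E k : s * cos x * cos (k%:R * (2 * pi / n%:R)) - s * sin x * sin (k%:R * (2 * pi / n%:R)) =
    s * cos (x + k%:R * (2 * pi / n%:R)) by rewrite cosD; ring.
apply: (iffP hasP) => [[k]|[k kn ck]].
  by rewrite mem_iota/= add0n E => kn ck; exists k.
by exists k; [rewrite mem_iota|rewrite /= E].
Qed.

(** The rotation permutes the caps cyclically: index [k] on the left is index [k + 1] on the right,
    and [n - 1] wraps around to [0] by periodicity. *)
Lemma in_caps_rotate n c s x : (0 < n)%N ->
  in_caps n c (s * cos (x + 2 * pi / n%:R), s * sin (x + 2 * pi / n%:R)) =
  in_caps n c (s * cos x, s * sin x).
Proof.
move=> n0; set T := 2 * pi / n%:R.
have nT : n%:R * T = 2 * pi by rewrite mulrC divfK// pnatr_eq0 -lt0n.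
apply/in_caps_polarP/in_caps_polarP; rewrite -/T => -[k kn ck].
- have [kn1|] := ltnP k.+1 n.
    by exists k.+1 => //; move: ck; rewrite -addrA -{1}(mul1r T) -mulrDl nat1r.
  move=> nk; have {nk} nk : k.+1 = n by apply/eqP; rewrite eqn_leq kn nk.
  exists 0%N => //; move: ck.
  by rewrite -addrA -{1}(mul1r T) -mulrDl nat1r nk nT cos_2piD mul0r addr0.
- case: k kn ck => [_|k kn]; last first.
    rewrite -nat1r mulrDl mul1r => ck; exists k; first exact: ltnW.
    by rewrite -addrA.
  rewrite mul0r addr0 => ck; exists n.-1; first by rewrite prednK.
  by rewrite -addrA -{1}(mul1r T) -mulrDl nat1r prednK// nT cos_2piD.
Qed.

(* cos x - cos (x + 2 t) = 2 sin (x + t) sin t, with t = k pi / n. *)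
Lemma in_caps_sector n c s x : (0 < n)%N -> 0 <= s -> - (pi / n%:R) <= x <= pi / n%:R ->
  in_caps n c (s * cos x, s * sin x) = (c <= s * cos x).
Proof.
move=> n0 s0 /andP[x1 x2]; apply/in_caps_polarP/idP => [[k kn ck]|ck]; last first.
  by exists 0%N => //; rewrite mul0r addr0.
apply: (le_trans ck); apply: ler_wpM2l => //.
case: k kn {ck} => [_|k kn]; first by rewrite mul0r addr0.
have pi0 := @pi_gt0 R.
set y := pi / n%:R in x1 x2 *.
have y0 : 0 < y by rewrite divr_gt0// ltr0n.
have ny : n%:R * y = pi by rewrite mulrC divfK// pnatr_eq0 -lt0n.
(* As [1 <= k + 1 <= n - 1], [t] lies between [y] and [pi - y]. With [|x| <= y] this puts both [t]
   and [x + t] in [[0, pi]], where the sine is nonnegative. *)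
pose t := k.+1%:R * y.
have ty : y <= t by rewrite /t -[X in X <= _]mul1r ler_pM2r// ler1n.
have t_pi : t + y <= pi.
  by rewrite -ny /t -[X in _ + X]mul1r -mulrDl natr1 ler_pM2r// ler_nat.
have -> : x + k.+1%:R * (2 * pi / n%:R) = (x + t) + t by rewrite /t /y; ring.
rewrite -{2}(addrK t x) cosD cosB -subr_ge0.
have -> : cos (x + t) * cos t + sin (x + t) * sin t -
    (cos (x + t) * cos t - sin (x + t) * sin t) = 2 * (sin (x + t) * sin t) by ring.
rewrite mulr_ge0// mulr_ge0//; apply: sin_ge0_pi; apply/andP; split; lra.
Qed.

(** Squaring turns the condition into [d <= z] with [d = 2 * (c / C) ^+ 2 - 1], so the integral is
    the length [1 - d] when [d < 1]. *)
Lemma integral_indic_cap c (C : R) : 0 <= c -> 0 < C ->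
  (\int[mu]_(z in `](-1)%R, 1%R[) ((c <= Num.sqrt ((1 + z) / 2) * C)%R%:R)%:E =
  (if c < C then 2 - 2 * c ^+ 2 / C ^+ 2 else 0)%:E)%E.
Proof.
move=> c0 C0; pose d := 2 * (c / C) ^+ 2 - 1.
have cC0 : 0 <= c / C by rewrite divr_ge0// ltW.
have dN1 : -1 <= d by rewrite /d lerBrDr addNr mulr_ge0// sqr_ge0.
have E z : z \in `](-1), 1[ -> (c <= Num.sqrt ((1 + z) / 2) * C) = (d <= z).
  rewrite in_itv/= => /andP[z1 _].
  rewrite -ler_pdivrMr// -{1}(ger0_norm cC0) -sqrtr_sqr ler_sqrt; last first.
    by rewrite divr_ge0//; lra.
  by rewrite ler_pdivlMr// /d lerBlDr mulrC addrC.
have d1 : (d < 1) = (c < C).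
  transitivity ((c / C) ^+ 2 < 1); first by rewrite /d; apply/idP/idP => ?; lra.
  by rewrite expr_lt1// ltr_pdivrMr// mul1r.
transitivity (mu (`[d, +oo[ `&` `](-1)%R, 1%R[)).
  rewrite -integral_indic//; apply: eq_integral => z; rewrite inE/= => z1.
  rewrite (E _ z1) indicE (_ : (z \in _) = (d <= z))//.
  by apply/idP/idP; rewrite inE/= in_itv/= andbT.
(* If [d = -1], that is [c = 0], the intersection is []-1, 1[], open at its left end; otherwise it
   is [[d, 1[]. *)
rewrite -d1; have [dN|dN] := eqVneq d (-1).
  rewrite setIidr; last first.
    by move=> z /=; rewrite !in_itv/= dN andbT => /andP[/ltW].
  rewrite lebesgue_measure_itv/= lte_fin -EFinB -dN; case: ifPn => // _.
  by rewrite /d exprMn exprVn; congr EFin; ring.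
rewrite (_ : _ `&` _ = `[d, 1%R[%classic).
  rewrite lebesgue_measure_itv/= lte_fin -EFinB; case: ifPn => // _.
  by rewrite /d exprMn exprVn; congr EFin; ring.
have {dN1} dN1 : -1 < d by rewrite lt_neqAle eq_sym dN.
apply/seteqP; split=> z/=; rewrite !in_itv/= andbT.
  by move=> [-> /andP[_ ->]].
by move=> /andP[dz ->]; rewrite dz (lt_le_trans dN1).
Qed.

Lemma integral_cos_lens r n : (2 <= n)%N -> 0 <= r <= pi / 2 ->
  let m := Num.min r (pi / n%:R) in
  (\int[mu]_(x in `](- m)%R, m[) (2 - 2 * cos r ^+ 2 / cos x ^+ 2)%:E =
  (4 * (m - cos r ^+ 2 * tan m))%:E)%E.
Proof.
move=> n2 /andP[r0 r2] m.
have pi0 := @pi_gt0 R.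
have n0 : (0 : R) < n%:R by rewrite ltr0n (leq_trans _ n2).
have m0 : 0 <= m by rewrite le_min r0 divr_ge0// ltW.
(* Here [r = pi / 2], and for [n = 2] the cosine vanishes at the endpoints, so the antiderivative
   [2 * x - 2 * cos r ^+ 2 * tan x] is not usable. The terms with [cos r] are simply zero. *)
have [c0|c0] := eqVneq (cos r) 0.
  under eq_integral do rewrite c0 expr0n mulr0 mul0r subr0.
  rewrite integral_cst//= lebesgue_measure_itv/= lte_fin c0 expr0n mul0r subr0.
  case: ifPn => [_|]; first by rewrite -EFinB -EFinM opprK; congr EFin; ring.
  rewrite -leNgt => mN; have -> : m = 0 by lra.
  by rewrite mulr0 mule0.
have [me0|mn0] := eqVneq m 0.
  by rewrite me0 oppr0 set_itvoo0 integral_set0 tan0 mulr0 subrr mulr0.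
have {mn0}m_gt0 : 0 < m by rewrite lt0r mn0.
have r_lt : r < pi / 2.
  by rewrite lt_neqAle r2 andbT; apply: contra_neq c0 => ->; rewrite cos_pihalf.
have mr : m <= r by rewrite ge_min lexx.
have cosx x : x \in `[- m, m] -> cos x != 0.
  rewrite in_itv/= => /andP[x1 x2]; rewrite gt_eqF// cos_gt0_pihalf//.
  by apply/andP; split; lra.
pose f x : R := 2 - 2 * cos r ^+ 2 * (cos x ^- 2).
pose F x : R := 2 * x - 2 * cos r ^+ 2 * tan x.
have cf x : x \in `[- m, m] -> {for x, continuous f}.
  move=> /cosx cx; apply: cvgB; first exact: cvg_cst.
  apply: cvgM; first exact: cvg_cst.
  apply: cvgV; first by rewrite expf_neq0.
  by apply: cvgM; exact: continuous_cos.
have dF x : x \in `[- m, m] -> is_derive x (1 : R) F (f x).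
  move=> /cosx cx; have dt := is_derive_tan cx.
  rewrite (_ : F = (2 : R) *: id - (2 * cos r ^+ 2) *: tan)//.
  by apply: is_derive_eq; rewrite /f /GRing.scale/= mulr1.
have cwf : {within `[- m, m], continuous f}.
  by apply: continuous_in_subspaceT => x; rewrite inE => /cf.
transitivity (\int[mu]_(x in `[(- m)%R, m]) (f x)%:E)%E.
  rewrite [RHS]integral_itv_bndoo//.
  apply/measurable_EFinP; apply: subspace_continuous_measurable_fun => //.
  by apply: continuous_subspaceW cwf; exact: subset_itv_oo_cc.
have cF x : x \in `[- m, m] -> {for x, continuous F}.
  by move=> /dF dFx; apply: differentiable_continuous; apply/derivable1_diffP; apply: ex_derive.
rewrite (@continuous_FTC2 _ f F)//.
- rewrite /F tanN -EFinB; congr EFin; ring.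
- by rewrite gtrN.
- split.
  + by move=> x /subset_itv_oo_cc /dF dFx; apply: ex_derive.
  + apply: cvg_at_right_filter; apply: cF; rewrite in_itv/= lexx; lra.
  + apply: cvg_at_left_filter; apply: cF; rewrite in_itv/= lexx andbT; lra.
- by move=> x /subset_itv_oo_cc xm; rewrite derive1E; have := dF _ xm => dFx; rewrite derive_val.
Qed.

(** After integration over the radial variable, the function [N] of the angle has period [2 pi / n],
    so a single sector counted [n] times suffices, and there only the cap of index [0] matters. *)
Lemma integral_caps n r : (2 <= n)%N -> 0 <= r <= pi / 2 ->
  let m := Num.min r (pi / n%:R) in
  (\int[mu]_(z in `](-1)%R, 1%R[) circle_integral (caps_indic n (cos r)) ((1 + z) / 2) =
  (n%:R * (4 * (m - cos r ^+ 2 * tan m)))%:E)%E.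
Proof.
move=> n2 r02 m; have n0 : (0 < n)%N by exact: leq_trans n2.
have pi0 := @pi_gt0 R.
have nR0 : (0 : R) < n%:R by rewrite ltr0n.
pose G := caps_indic n (cos r).
pose H (u : R * R) := G (Num.sqrt ((1 + u.1) / 2) * cos u.2, Num.sqrt ((1 + u.1) / 2) * sin u.2).
have mH : measurable_fun setT H.
  apply: measurableT_comp; first exact: measurable_caps_indic.
  have ms : measurable_fun setT (fun u : R * R => Num.sqrt ((1 + u.1) / 2)).
    apply: measurableT_comp; first exact: measurable_sqrt.
    by apply: measurable_funM => //; exact: measurable_funD.
  apply: measurable_fun_pair; apply: measurable_funM => //; apply: measurableT_comp => //.
    exact: measurable_cos.
  exact: measurable_sin.
have H0 u : (0 <= H u)%E by exact: caps_indic_ge0.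
pose N x := (\int[mu]_(z in `](-1)%R, 1%R[) H (z, x))%E.
have mN : measurable_fun setT N.
  apply: (@measurable_ge0_integral2 _ _ _ _ R mu (fun u : R * R => H (u.2, u.1))) => //.
  by apply: measurableT_comp => //; exact: measurable_fun_pair.
have N0 x : (0 <= N x)%E by apply: integral_ge0.
pose T : R := 2 * pi / n%:R.
have T0 : 0 < T by rewrite divr_gt0// mulr_gt0.
have NT x : N (x + T) = N x.
  by apply: eq_integral => z _; rewrite /H /G/= !caps_indicE in_caps_rotate.
transitivity (\int[mu]_(x in `]0%R, (2 * pi)%R[) N x)%E.
  exact: (ge0_integral_swap_on (F := H)).
have -> : 2 * pi = T *+ n.
  by rewrite -(mulr_natr T n) /T divfK// gt_eqF.
rewrite ge0_integral_periodicMn// EFinM; congr (_ * _)%E.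
(* A shift by half a period centres the window on the axis of the cap. *)
rewrite -(ge0_integral_periodic (- (T / 2)) T0)//.
rewrite ge0_integral_itv_translate// add0r.
have -> : T - T / 2 = pi / n%:R by rewrite /T; field; rewrite gt_eqF.
have -> : T / 2 = pi / n%:R by rewrite /T; field; rewrite gt_eqF.
rewrite -integral_cos_lens// integral_mkcond [RHS]integral_mkcond.
apply: eq_integral => x _; rewrite !patchE -/m.
have npi : pi / n%:R <= pi / 2 :> R by rewrite ler_pM2l// lef_pV2 ?posrE// ler_nat.
have memE y : (x \in `](- y)%R, y[%classic) = (`|x| < y).
  by apply/idP/idP; rewrite inE/= in_itv/= ltr_norml.
rewrite !memE lt_min andbC; case: ifPn => //= xn.
have xn' : - (pi / n%:R) <= x <= pi / n%:R.
  by move: xn; rewrite ltr_norml => /andP[/ltW-> /ltW->].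
have cx : 0 < cos x.
  by apply: cos_gt0_pihalf; move: xn; rewrite ltr_norml => /andP[? ?]; apply/andP; split; lra.
have cr : 0 <= cos r.
  by move: r02 => /andP[? ?]; apply: cos_ge0_pihalf; apply/andP; split; lra.
transitivity (\int[mu]_(z in `](-1)%R, 1%R[) ((cos r <= Num.sqrt ((1 + z) / 2) * cos x)%R%:R)%:E)%E.
  apply: eq_integral => z _; rewrite /H /G caps_indicE/= in_caps_sector//.
rewrite integral_indic_cap//.
(* The cap is met only by rays with [|x| < r], which shrinks the sector to half-width [m]. *)
have -> : (cos r < cos x) = (`|x| < r).
  move: r02 => /andP[r0 r2].
  have rI : r \in `[0, pi] by rewrite in_itv/= r0/=; lra.
  have xI : `|x| \in `[0, pi].
    by rewrite in_itv/= normr_ge0/= (le_trans (ltW xn))// (le_trans npi)//; lra.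
  by rewrite -(cos_norm x) ltr_cos.
by case: ifPn.
Qed.

End caps.


(** * The round metric in Hopf coordinates *)

Section metric.
Local Open Scope complex_scope.
Context {R : realType}.
Implicit Types (a b c t x y : R) (u v : R * R * R).

(** Reduces the partial derivatives in the Jacobian to derivatives in one variable. *)
Lemma derive_line (V : normedModType R) (f : V -> R) (v p : V) (d : R) :
  is_derive (0 : R) (1 : R) (fun h : R => f (h *: v + p)) d -> 'D_v f p = d.
Proof.
move=> /@derive_val <-; apply: (congr1 (fun g : R -> R => lim (g @ 0^'))).
apply/funext => h /=; rewrite addr0 scale0r add0r.
by rewrite [in RHS]/GRing.scale/= mulr1.
Qed.

Lemma is_derive_cos_line a x :
  is_derive (0 : R) (1 : R) (fun h : R => cos (h * a + x)) (- (a * sin x)).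
Proof.
have dl : is_derive (0 : R) (1 : R) (fun h : R => h * a + x) a.
  rewrite (_ : (fun h : R => h * a + x) = a *: id + cst x); last first.
    by apply/funext => h; rewrite !fctE /GRing.scale/= mulrC.
  by apply: is_derive_eq; rewrite /GRing.scale/= mulr1 addr0.
have := @is_derive1_comp _ cos (fun h => h * a + x) 0 _ _ (is_derive_cos _) dl.
by rewrite mul0r add0r mulNr mulrC.
Qed.

Lemma is_derive_sin_line a x :
  is_derive (0 : R) (1 : R) (fun h : R => sin (h * a + x)) (a * cos x).
Proof.
have dl : is_derive (0 : R) (1 : R) (fun h : R => h * a + x) a.
  rewrite (_ : (fun h : R => h * a + x) = a *: id + cst x); last first.
    by apply/funext => h; rewrite !fctE /GRing.scale/= mulrC.
  by apply: is_derive_eq; rewrite /GRing.scale/= mulr1 addr0.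
have := @is_derive1_comp _ sin (fun h => h * a + x) 0 _ _ (is_derive_sin _) dl.
by rewrite mul0r add0r mulrC.
Qed.

Lemma real4_hopf u : real4 (val (hopf u)) = \row_(k < 4)
  [:: cos u.1.1 * cos u.1.2; cos u.1.1 * sin u.1.2; sin u.1.1 * cos u.2; sin u.1.1 * sin u.2]`_k.
Proof.
apply/rowP => k; rewrite !mxE/=.
by case: k => -[|[|[|[|//]]]] /= _; rewrite ?mul0r ?subr0 ?addr0.
Qed.

(** The direction [e] stays symbolic, so that one use of the product rule per column serves all
    three coordinate directions. *)
Lemma hopf_jacE u i k : hopf_jac u i k =
  (let e := basis3 R i in
   let: (t, x, y) := u in
   [:: - e.1.1 * sin t * cos x - cos t * (e.1.2 * sin x);
       - e.1.1 * sin t * sin x + cos t * (e.1.2 * cos x);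
       e.1.1 * cos t * cos y - sin t * (e.2 * sin y);
       e.1.1 * cos t * sin y + sin t * (e.2 * cos y)]`_k).
Proof.
rewrite mxE; case: (basis3 R i) => -[a b] c /=; case: u => -[t x] y /=.
apply: derive_line.
rewrite (_ : (fun h : R => _) = fun h : R =>
  [:: cos (h * a + t) * cos (h * b + x); cos (h * a + t) * sin (h * b + x);
      sin (h * a + t) * cos (h * c + y); sin (h * a + t) * sin (h * c + y)]`_k); last first.
  by apply/funext => h; rewrite real4_hopf mxE.
have dct := is_derive_cos_line a t; have dst := is_derive_sin_line a t.
have dcx := is_derive_cos_line b x; have dsx := is_derive_sin_line b x.
have dcy := is_derive_cos_line c y; have dsy := is_derive_sin_line c y.
case: k => -[|[|[|[|//]]]] /= _.
- apply: (@is_derive_eq _ _ _ _ _ _ _ _ (is_deriveM dct dcx) _).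
  by rewrite /GRing.scale/= !mul0r !add0r; ring.
- apply: (@is_derive_eq _ _ _ _ _ _ _ _ (is_deriveM dct dsx) _).
  by rewrite /GRing.scale/= !mul0r !add0r; ring.
- apply: (@is_derive_eq _ _ _ _ _ _ _ _ (is_deriveM dst dcy) _).
  by rewrite /GRing.scale/= !mul0r !add0r; ring.
- apply: (@is_derive_eq _ _ _ _ _ _ _ _ (is_deriveM dst dsy) _).
  by rewrite /GRing.scale/= !mul0r !add0r; ring.
Qed.

Lemma hopf_metricE u : hopf_metric u =
  diag_mx (\row_(i < 3) [:: 1; cos u.1.1 ^+ 2; sin u.1.1 ^+ 2]`_i).
Proof.
case: u => -[t x] y; apply/matrixP => i j.
transitivity (\sum_k hopf_jac (t, x, y) i k * hopf_jac (t, x, y) j k).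
  by rewrite mxE; apply: eq_bigr => k _; congr (_ * _); rewrite mxE.
under eq_bigr do rewrite !hopf_jacE.
rewrite !big_ord_recl big_ord0 !mxE/=.
have ct := cos2sin2 t; have cx := cos2sin2 x; have cy := cos2sin2 y.
by case: i => -[|[|[|//]]] /= ?; case: j => -[|[|[|//]]] /= ?; rewrite ?mulr1n ?mulr0n;
  ring: ct cx cy.
Qed.

Lemma sqrt_det_hopf_metric u : hopf_dom u ->
  Num.sqrt (\det (hopf_metric u)) = cos u.1.1 * sin u.1.1.
Proof.
move=> [[/= t0 _] _].
rewrite hopf_metricE det_diag !big_ord_recl big_ord0 !mxE/= mul1r mulr1 -exprMn sqrtr_sqr.
by rewrite ger0_norm// mul_cos_sin_ge0.
Qed.

End metric.

(** * Balls of the lens space *)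

Section roots.
Local Open Scope complex_scope.
Context {R : realType}.
Implicit Types (t x y : R).

Lemma expiD x y : expi (x + y) = expi x * expi y.
Proof. by rewrite /expi cosD sinD; apply/eqP; rewrite eq_complex/= eqxx/= addrC eqxx. Qed.

Lemma expiX x n : expi x ^+ n = expi (n%:R * x).
Proof.
elim: n => [|n IH]; first by rewrite expr0 mul0r /expi cos0 sin0.
by rewrite exprS IH -expiD -nat1r mulrDl mul1r.
Qed.

(** The listed exponentials are [n] distinct roots of unity, and there cannot be more than [n]. *)
Lemma unity_root_set n : (0 < n)%N ->
  [set w : R[i] | n.-unity_root w] =
  [set expi (k%:R * (2 * pi / n%:R)) | k in [set k | (k < n)%N]].
Proof.
move=> n0; set T : R := 2 * pi / n%:R.
have nT : n%:R * T = 2 * pi by rewrite mulrC divfK// pnatr_eq0 -lt0n.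
have rootT k : n.-unity_root (expi (k%:R * T)).
  rewrite unity_rootE expiX mulrCA nT -expiX mulr_natl.
  by rewrite /expi cos2pi sin2pi expr1n.
pose s := [seq expi (k%:R * T) | k <- iota 0 n].
(* Equal values would make the cosine of the angle difference [1], hence the sine of half of it [0];
   but this half, [(j - i) pi / n], is strictly between [0] and [pi]. *)
have ltinj i j : (i < j < n)%N -> expi (i%:R * T) <> expi (j%:R * T).
  move=> /andP[ij jn] [ci si].
  have : cos (j%:R * T - i%:R * T) = 1 by rewrite cosB ci si -!expr2 cos2Dsin2.
  have -> : j%:R * T - i%:R * T = ((j - i)%:R * (pi / n%:R)) *+ 2.
    by rewrite natrB ?(ltnW ij)// /T -mulr_natl; ring.
  rewrite cos_mulr2n => h.
  have ji : (0 < j - i)%N by rewrite subn_gt0.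
  have jin : (j - i < n)%N by rewrite (leq_ltn_trans _ jn)// leq_subr.
  have : 0 < sin ((j - i)%:R * (pi / n%:R) : R).
    apply: sin_gt0_pi; rewrite mulr_gt0 ?ltr0n ?divr_gt0 ?pi_gt0 ?ltr0n//=.
    by rewrite mulrCA -[X in _ < X]mulr1 ltr_pM2l ?pi_gt0// ltr_pdivrMr ?ltr0n// mul1r ltr_nat.
  have : sin ((j - i)%:R * (pi / n%:R) : R) ^+ 2 = 0.
    by rewrite sin2cos2; move: h; set C := cos _ ^+ 2; rewrite mulr2n => h; lra.
  by move/eqP; rewrite sqrf_eq0 => /eqP ->; rewrite ltxx.
have us : uniq s.
  rewrite map_inj_in_uniq ?iota_uniq// => i j; rewrite !mem_iota/= !add0n => ni nj e.
  case: (ltngtP i j) => // ij; exfalso.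
    by apply: (@ltinj i j) => //; rewrite ij.
  by apply: (@ltinj j i) => //; rewrite ij.
have := @mem_unity_roots _ n s n0.
rewrite us size_map size_iota => /(_ _ erefl erefl) memE.
have alls : all n.-unity_root s by apply/allP => _ /mapP[k _ ->].
apply/seteqP; split => w /=; last by move=> [k kn <-].
rewrite -[n.-unity_root w]/(w \in n.-unity_root) memE// => /mapP[k].
  rewrite mem_iota/= add0n => kn ->.
by exists k.
Qed.

(** A finite nonempty family attains its infimum. *)
Lemma inf_finite_le (f : nat -> R) n r : (0 < n)%N ->
  (inf [set f k | k in [set k | (k < n)%N]] <= r) <-> (exists2 k, (k < n)%N & f k <= r).
Proof.
case: n => // n _.
have [i0 _ min0] := @arg_minP _ _ 'I_n.+1 ord0 xpredT (fun i => f i) isT.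
have lb : has_lbound [set f k | k in [set k | (k < n.+1)%N]].
  by exists (f i0) => _ [k /= kn <-]; exact: (min0 (Ordinal kn)).
split=> [infr|[k kn fkr]].
  exists i0 => //; apply: le_trans infr; apply: lb_le_inf.
    by exists (f 0%N), 0%N.
  by move=> _ [k /= kn <-]; exact: (min0 (Ordinal kn)).
by apply: le_trans fkr; apply: ge_inf => //; exists k.
Qed.

Lemma acos_le x r : -1 <= x <= 1 -> 0 <= r <= pi -> (acos x <= r) = (cos r <= x).
Proof.
move=> x1 rpi; rewrite -{2}(@acosK _ x) ?in_itv//= [LHS]leNgt [RHS]leNgt ltr_cos ?in_itv//=.
by rewrite acos_ge0// acos_lepi.
Qed.

(** Both [|p - q|^2] and [|p + q|^2] are nonnegative, and for unit vectors they equal [2 - 2 p.q]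
    and [2 + 2 p.q]. *)
Lemma dot_le1 (p q : C2 R) : dot p p = 1 -> dot q q = 1 -> -1 <= dot p q <= 1.
Proof.
rewrite /dot !big_ord_recl !big_ord0.
set a0 := real4 p _ _; set a1 := real4 p _ _; set a2 := real4 p _ _; set a3 := real4 p _ _.
set b0 := real4 q _ _; set b1 := real4 q _ _; set b2 := real4 q _ _; set b3 := real4 q _ _.
move=> pp qq.
have := sqr_ge0 (a0 - b0); have := sqr_ge0 (a1 - b1).
have := sqr_ge0 (a2 - b2); have := sqr_ge0 (a3 - b3).
have := sqr_ge0 (a0 + b0); have := sqr_ge0 (a1 + b1).
have := sqr_ge0 (a2 + b2); have := sqr_ge0 (a3 + b3).
by move=> *; apply/andP; split; lra.
Qed.

Lemma S3_real (p : S3 R) : (complex.Re (val p).1) ^+ 2 + (complex.Im (val p).1) ^+ 2 +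
  ((complex.Re (val p).2) ^+ 2 + (complex.Im (val p).2) ^+ 2) = 1.
Proof.
case: p => -[[a b] [c d]] /=; rewrite !normc_def /= -!rmorphXn /=.
by rewrite !sqr_sqrtr ?addr_ge0 ?sqr_ge0// -rmorphD/= => /eqP[].
Qed.

Lemma dot_self (p : S3 R) : dot (val p) (val p) = 1.
Proof.
have := S3_real p; case: (val p) => [[a b] [c d]] /= <-.
by rewrite /dot !big_ord_recl !big_ord0 !mxE/=; ring.
Qed.

Lemma norm_expi t : `|expi t| = 1.
Proof. by rewrite /expi normc_def/= cos2Dsin2 sqrtr1. Qed.

End roots.

(** * Balls as preimages of the caps under the Hermitian product *)

Section ball.
Local Open Scope complex_scope.
Context {R : realType}.
Local Notation mu := (@lebesgue_measure R).
Implicit Types (C S a b r : R) (u : R * R * R).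

(* The Hermitian product of [hopf u] with [(C e^(-ia), S e^(-ib))]. *)
Definition hermitian_hopf C S a b u : R * R :=
  (cos u.1.1 * C * cos (u.1.2 + a) + sin u.1.1 * S * cos (u.2 + b),
   cos u.1.1 * C * sin (u.1.2 + a) + sin u.1.1 * S * sin (u.2 + b)).

Lemma measurable_hermitian_hopf C S a b : measurable_fun setT (hermitian_hopf C S a b).
Proof.
have mcos := @measurable_cos R.
have msin := @measurable_sin R.
have m11 : measurable_fun setT (fun u : R * R * R => u.1.1) by exact: measurableT_comp.
have m12 : measurable_fun setT (fun u : R * R * R => u.1.2) by exact: measurableT_comp.
have mx : measurable_fun setT (fun u : R * R * R => u.1.2 + a) by exact: measurable_funD.
have my : measurable_fun setT (fun u : R * R * R => u.2 + b) by exact: measurable_funD.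
by apply: measurable_fun_pair; apply: measurable_funD; apply: measurable_funM;
  try (apply: measurable_funM => //); exact: measurableT_comp.
Qed.

(** The real inner product is the real part of the Hermitian product [h], here [Re (e^(it) h)]. The
    angles of [p] enter with a minus sign because [p] is conjugated. *)
Lemma dot_rot_hopf t (p : C2 R) C S a b u :
  complex.Re p.1 = C * cos a -> complex.Im p.1 = C * sin a ->
  complex.Re p.2 = S * cos b -> complex.Im p.2 = S * sin b ->
  dot (Defs.rot (expi t) (val (hopf u))) p =
  (hermitian_hopf C S (- a) (- b) u).1 * cos t - (hermitian_hopf C S (- a) (- b) u).2 * sin t.
Proof.
case: p => [[a1 b1] [a2 b2]] /= -> -> -> ->; case: u => [[s x] y].
by rewrite /dot !big_ord_recl !big_ord0 !mxE/= !cosB !sinB; ring.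
Qed.

Lemma lens_ball_hopf n r (p : S3 R) C S a b u : (0 < n)%N -> 0 <= r <= pi ->
  complex.Re (val p).1 = C * cos a -> complex.Im (val p).1 = C * sin a ->
  complex.Re (val p).2 = S * cos b -> complex.Im (val p).2 = S * sin b ->
  lens_ball (lens_proj n p) r (lens_proj n (hopf u)) <->
  in_caps n (cos r) (hermitian_hopf C S (- a) (- b) u).
Proof.
move=> n0 rpi p1 p2 p3 p4; rewrite /lens_ball/= lens_dist_proj unity_root_set// image_comp.
have E k : sphere_dist (Defs.rot (expi (k%:R * (2 * pi / n%:R))) (val (hopf u))) (val p) <= r =
    (cos r <= (hermitian_hopf C S (- a) (- b) u).1 * cos (k%:R * (2 * pi / n%:R)) -
      (hermitian_hopf C S (- a) (- b) u).2 * sin (k%:R * (2 * pi / n%:R))).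
  rewrite /sphere_dist acos_le// ?(dot_rot_hopf _ _ p1 p2 p3 p4)//.
  by rewrite -(dot_rot_hopf _ _ p1 p2 p3 p4) dot_le1// ?dot_rot ?norm_expi// dot_self.
split.
  move=> /(inf_finite_le _ _ n0)[k kn]; rewrite /= E => ck.
  by apply/hasP; exists k => //; rewrite mem_iota.
move=> /hasP[k]; rewrite mem_iota/= add0n => kn ck.
by apply/(inf_finite_le _ _ n0); exists k => //=; rewrite E.
Qed.

(** The constant is [pi / 2] from the law of the Hermitian product times [4 n] from the caps; the
    factor [n] will cancel against the number of sheets. *)
Lemma sphere_vol_caps n r (p : S3 R) : (2 <= n)%N -> 0 <= r <= pi / 2 ->
  let m := Num.min r (pi / n%:R) in
  sphere_vol (@lens_proj R n @^-1` lens_ball (lens_proj n p) r) =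
  (n%:R * (2 * pi * (m - cos r ^+ 2 * tan m)))%:E.
Proof.
move=> n2 r02 m; have n0 : (0 < n)%N by exact: leq_trans n2.
have pi0 := @pi_gt0 R.
have rpi : 0 <= r <= pi by move: r02 => /andP[? ?]; apply/andP; split; lra.
move: (polar_decomposition (complex.Re (val p).1) (complex.Im (val p).1)).
move: (polar_decomposition (complex.Re (val p).2) (complex.Im (val p).2)).
move=> [S [b [_ S2 p3 p4]]] [C [a [_ C2 p1 p2]]].
have CS : C ^+ 2 + S ^+ 2 = 1 by rewrite C2 S2 S3_real.
have mcos := @measurable_cos R.
have msin := @measurable_sin R.
have m11 : measurable_fun setT (fun u : R * R * R => u.1.1) by exact: measurableT_comp.
(* The absolute value keeps the integrand nonnegative off the chart domain, as Tonelli
   requires. *)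
pose F' u : \bar R := (caps_indic n (cos r) (hermitian_hopf C S (- a) (- b) u) *
  `|cos u.1.1 * sin u.1.1|%:E)%E.
have mF' : measurable_fun setT F'.
  apply: emeasurable_funM.
    apply: measurableT_comp; first exact: measurable_caps_indic.
    exact: measurable_hermitian_hopf.
  apply/measurable_EFinP; apply: measurableT_comp => //.
  by apply: measurable_funM; exact: measurableT_comp.
have F'0 u : (0 <= F' u)%E by rewrite mule_ge0 ?caps_indic_ge0// lee_fin.
have cs0 (t : R) : t \in `]0, (pi / 2)[ -> `|cos t * sin t| = cos t * sin t.
  by move=> /mul_cos_sin_ge0; exact: ger0_norm.
(* Membership in the ball moves from the domain of integration into the integrand, as an
   indicator. *)
transitivity (\int[(mu \x mu) \x mu]_(u in @hopf_dom R) F' u)%E.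
  rewrite /sphere_vol integral_mkcondr; apply: eq_integral => u; rewrite inE => domu.
  rewrite patchE sqrt_det_hopf_metric// /F' caps_indicE cs0; last by case: domu => -[].
  have := lens_ball_hopf u n0 rpi p1 p2 p3 p4; case: ifPn => [|].
    by rewrite inE/= => H /iffLR/(_ H) ->; rewrite mul1e.
  rewrite notin_setE/= => H /iffRL H'; case: (boolP (in_caps _ _ _)) => [/H'//|_].
  by rewrite mul0e.
transitivity (\int[mu]_(t in `]0%R, (pi / 2)%R[) \int[mu]_(x in `]0%R, (2 * pi)%R[)
    \int[mu]_(y in `]0%R, (2 * pi)%R[) F' (t, x, y))%E.
  exact: (@ge0_integral_setX3 _ _ _ (measurableTypeR R) (measurableTypeR R) (measurableTypeR R)
    R mu mu mu F' _ _ _ (measurable_itv _) (measurable_itv _) (measurable_itv _) mF' F'0).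
transitivity ((pi / 2)%:E * \int[mu]_(z in `](-1)%R, 1%R[)
    circle_integral (caps_indic n (cos r)) ((1 + z) / 2))%E.
  rewrite -(ge0_integral_hopf (measurable_caps_indic n (cos r))
    (caps_indic_ge0 n (cos r)) (- a) (- b) CS).
  apply: eq_integral => t; rewrite inE/= => t0.
  apply: eq_integral => x _; apply: eq_integral => y _.
  by rewrite /F'/= cs0.
rewrite integral_caps// -EFinM; congr EFin; rewrite -/m.
by field.
Qed.

End ball.

Theorem theorem4 (R : realType) (n : nat) (hn : (2 <= n)%N)
    (r : R) (hr : 0 <= r <= pi / 2) (q : lens R n) :
  lens_vol (lens_ball q r) =
    (if r <= pi / n%:R then 2 * pi * (r - sin r * cos r)
     else 2 * pi ^+ 2 / n%:R - 2 * pi * cos r ^+ 2 * tan (pi / n%:R))%:E.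
Proof.
have nR : n%:R != 0 :> R by rewrite pnatr_eq0 -lt0n (leq_trans _ hn).
rewrite /lens_vol -[q]reprK -/(lens_proj n (repr q)) sphere_vol_caps// -EFinM; congr EFin.
rewrite mulKf//; case: leP => rn; last by field.
(* In this case [m = r], and [cos r ^+ 2 * tan r = sin r * cos r] follows by cancelling [cos r]. The
   value [cos r = 0] is treated apart; both sides of this identity are then [0]. *)
have [c0|c0] := eqVneq (cos r) 0.
  by rewrite c0 expr0n mul0r mulr0.
by rewrite /tan; field.
Qed.
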